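(* Let $p$ be a prime and $G$ a $p$-group of maximal class of order $p^n$. If $p\in\{2,3\}$ or $n\le 3$, then every non-abelian subgroup $H$ of $G$ satisfies $C_G(H)\le H$. If $p\ge 5$ and $n\ge 4$, then every non-abelian subgroup $H$ of $G$ satisfies $C_G(H)\le H$ if and only if the subgroup $P_1(G)=C_G(\gamma_2(G)/\gamma_4(G))$ is abelian.
   Context: A group of order $p^n$ ($n\ge 2$) has maximal class if its nilpotency class is $n-1$. $\gamma_i(G)$ denotes the $i$-th term of the lower central series ($\gamma_1(G)=G$, $\gamma_{i+1}(G)=[\gamma_i(G),G]$). For $n\ge 4$, $P_1(G)=C_G(\gamma_2(G)/\gamma_4(G))$ is the centralizer in $G$ of the section $\gamma_2(G)/\gamma_4(G)$ (the ''2-step centralizer''), a maximal subgroup of $G$. $C_G(H)$ denotes the centralizer of $H$ in $G$. *)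

(* Defs.v *)
From mathcomp Require Import all_boot all_fingroup all_solvable.
Set Implicit Arguments. Unset Strict Implicit. Unset Printing Implicit Defensive.
Local Open Scope group_scope.

Definition maximal_class (gT : finGroupType) (p n : nat) (G : {group gT}) : bool :=
  [&& 2 <= n, #|G| == (p ^ n)%N & nil_class G == n.-1].

(* P_1(G) = C_G(gamma_2(G)/gamma_4(G)): the elements x of G acting trivially
   on the section 'L_2(G)/'L_4(G), i.e. [y, x] \in 'L_4(G) for all y in 'L_2(G). *)
Definition P1 (gT : finGroupType) (G : {group gT}) : {set gT} :=
  [set x in G | [forall y in 'L_2(G), [~ y, x] \in 'L_4(G)]].

Definition nonabelian_selfcentralizing (gT : finGroupType) (G : {group gT}) : Prop :=
  forall H : {group gT}, H \subset G -> ~~ abelian H -> 'C_G(H) \subset H.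

(* Main.v *)
Require Import Defs.
From mathcomp Require Import all_boot all_fingroup all_solvable.
From mathcomp Require Import ssralg zify.
Set Implicit Arguments. Unset Strict Implicit. Unset Printing Implicit Defensive.
Local Open Scope group_scope.

(** Let G have maximal class and order p^n. Every normal subgroup of index at
  least p^2 is a term 'L_i(G) of the lower central series. For s outside all the
  centralizers C_i of the sections 'L_i(G) / 'L_i.+2(G) for 1 < i <= j, s^p lies
  in 'L_j.+1(G); expanding (s [s, b])^p = (s^p)^b in an abelian normal subgroup
  then shows that an abelian 'L_m(G) of order less than p^p has exponent
  dividing p, as p - 1 proper subgroups never cover G.

  If P1 is abelian, or p <= 3, or n <= 3, there is a maximal subgroup M such that
  the elements outside M have centralizers of order at most p^2, so that a
  nonabelian H not contained in M has C_G(H) = Z(G) = Z(H). For p = 2, P1 is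
  cyclic; for p = 3 and n > 4, 'L_3(G) is both central in P1 and contained in
  its Frattini subgroup, so that P1 has no proper nonabelian subgroup.

  Conversely let p >= 5 and let P1 be nonabelian. Take B <= P1 minimal among the
  nonabelian normal subgroups of G, and A = 'L_m(G) abelian of index p in B; then
  Z(B) = 'L_k(G) with m < k <= n - 2. If b is in B but not in A and a is in A but
  not in Z(B), then self-centralization of <a, b> puts Z(B) inside every
  L <= Z(B) that contains a^p, b^p and [a, b]. Since 'L_(n - 4)(G) has exponent p
  when it is abelian, a suitable choice of a makes L too small to contain Z(B),
  except for m = n - 3 and k = n - 2, where b^p is forced to lie both outside
  and inside Z(G) = 'L_n.-1(G). *)

(** * Groups of maximal class *)

(** The usual three subgroups lemma, applied to the images in [G / N]. *)
Lemma three_subgroup_normal (gT : finGroupType) (G N A B C : {group gT}) :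
    N <| G -> A \subset G -> B \subset G -> C \subset G ->
    [~: A, B, C] \subset N -> [~: B, C, A] \subset N -> [~: C, A, B] \subset N.
Proof.
case/andP=> _ nNG sA sB sC.
have nS (H : {group gT}) : H \subset G -> H \subset 'N(N).
  by move=> sHG; apply: subset_trans nNG.
have quo (H K L : {group gT}) : H \subset G -> K \subset G -> L \subset G ->
    ([~: H, K, L] \subset N) = ([~: H / N, K / N, L / N] == 1).
  move=> sH sK sL; have sHK : [~: H, K] \subset G by rewrite comm_subG.
  rewrite -quotient_sub1 ?nS ?comm_subG // -subG1.
  by rewrite (quotientR (nS [group of [~: H, K]] sHK)) ?quotientR ?nS.
rewrite !quo // => /eqP abc /eqP bca; apply/eqP; exact: three_subgroup.
Qed.

(** Induction on [j]: the second term is itself a commutator with [G], and the three subgroups lemma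
    moves that [G] onto the first term. *)
Lemma lcn_comm (gT : finGroupType) (G : {group gT}) i j :
  0 < i -> 0 < j -> [~: 'L_i(G), 'L_j(G)] \subset 'L_(i + j)(G).
Proof.
case: i j => // i [] // j _ _; elim: j i => [|j IHj] i.
  by rewrite lcn1 addn1 lcnSn.
rewrite [X in [~: _, X]]lcnSn commGC.
apply: (@three_subgroup_normal _ G 'L_(i.+1 + j.+2)(G) G 'L_i.+1(G) 'L_j.+1(G));
  rewrite ?lcn_normal ?lcn_sub //=.
  rewrite [X in [~: X, _]]commGC -lcnSn.
  by apply: subset_trans (IHj i.+1) _; rewrite addSnnS.
by apply: subset_trans (commSg _ (IHj i)) _; rewrite addSn -lcnSn !addnS.
Qed.

Lemma quotient_lcn (gT : finGroupType) (G H : {group gT}) i :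
  G \subset 'N(H) -> 'L_i(G) / H = 'L_i(G / H).
Proof. exact: morphim_lcn. Qed.

Section MaximalClass.
Variables (gT : finGroupType) (p n : nat) (G : {group gT}).
Hypotheses (p_pr : prime p) (maxG : maximal_class p n G).

Lemma maxcl_gt1 : 1 < n. Proof. by case/and3P: maxG. Qed.
Lemma maxcl_card : #|G| = (p ^ n)%N. Proof. by case/and3P: maxG => _ /eqP. Qed.
Lemma maxcl_class : nil_class G = n.-1. Proof. by case/and3P: maxG => _ _ /eqP. Qed.

Lemma maxcl_pgroup : p.-group G.
Proof. by rewrite /pgroup maxcl_card pnatX pnat_id. Qed.

Lemma maxcl_logn : logn p #|G| = n.
Proof. by rewrite maxcl_card pfactorK. Qed.

Lemma maxcl_lcn1 i : (n <= i) = ('L_i(G) == 1).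
Proof.
have nilG := pgroup_nil maxcl_pgroup.
have n2 := maxcl_gt1.
case: i => [|i].
  (* By convention ['L_0(G)] is [G], which is nontrivial because [n] is positive. *)
  rewrite leqn0 lcn0; case: (n) n2 (maxcl_card) => // m _ cG; apply/esym/negbTE.
  by rewrite trivg_card1 cG -(expn0 p) eqn_exp2l ?prime_gt1.
rewrite -(sameP (lcn_nil_classP i nilG) eqP) maxcl_class.
by case: (n) n2.
Qed.

Lemma maxcl_lcn_proper i : 0 < i -> i < n -> 'L_i.+1(G) \proper 'L_i(G).
Proof.
case: i => // i _ lt_in; rewrite lcnSn.
apply: (nil_comm_properl (pgroup_nil maxcl_pgroup)).
- exact: lcn_sub.
- by rewrite -maxcl_lcn1 -ltnNge.
by rewrite subsetI subxx lcn_norm.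
Qed.

(** Counting proper inclusions up from ['L_n(G) = 1] bounds the order below. For the upper bound,
    [G / 'L_2(G)] is not cyclic, so it has order at least [p ^ 2], and each later step loses at
    least a factor [p]. This double first step is why [i = 1] is excluded. *)
Lemma maxcl_logn_lcn i : 1 < i -> logn p #|'L_i(G)| = n - i.
Proof.
move=> i_gt1; have pL k : p.-group 'L_k(G) := pgroupS (lcn_sub k G) maxcl_pgroup.
have [le_ni|lt_in] := leqP n i.
  by have := le_ni; rewrite maxcl_lcn1 => /eqP->; rewrite cards1 logn1; lia.
have low k : k < n -> k <= logn p #|'L_(n - k)(G)|.
  elim: k => // k IHk lt_kn; apply: leq_ltn_trans (IHk (ltnW lt_kn)) _.
  apply: properG_ltn_log (pL _) _.
  have ->: n - k = (n - k.+1).+1 by lia.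
  by apply: maxcl_lcn_proper; lia.
have := low (n - i); rewrite (subKn (ltnW lt_in)) => /(_ ltac:(lia)) lowi.
apply/eqP; rewrite eqn_leq lowi andbT {lowi low}.
elim: i i_gt1 lt_in => // -[|[|i]] // IHi _ lt_in.
  rewrite leqNgt; apply/negP => lt_n2.
  suffices /cyclic_abelian/derG1P G1 : cyclic G.
    by have := maxcl_lcn1 2; rewrite lcn2 G1 eqxx leqNgt lt_in.
  apply: (cyclic_nilpotent_quo_der1_cyclic (pgroup_nil maxcl_pgroup)).
  have pGq : p.-group (G / G^`(1)) by rewrite quotient_pgroup ?maxcl_pgroup.
  apply: (dvdn_prime_cyclic p_pr); rewrite (card_pgroup pGq).
  apply: (@dvdn_exp2l p _ 1).
  rewrite card_quotient ?der_norm // -divgS ?der_sub // logn_div ?cardSg ?der_sub //.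
  by rewrite maxcl_logn; apply: leq_trans (leq_sub2l n lt_n2) _; lia.
have lt_log := properG_ltn_log (pL _) (maxcl_lcn_proper (isT : 0 < i.+2) (ltnW lt_in)).
rewrite -ltnS; apply: leq_trans (leq_trans lt_log (IHi isT (ltnW lt_in))) _; lia.
Qed.

Lemma maxcl_card_lcn i : 1 < i -> #|'L_i(G)| = (p ^ (n - i))%N.
Proof.
move=> i_gt1; rewrite -maxcl_logn_lcn //.
exact: card_pgroup (pgroupS (lcn_sub i G) maxcl_pgroup).
Qed.

Lemma maxcl_lcn_notin i : 0 < i -> i < n -> exists2 y, y \in 'L_i(G) & y \notin 'L_i.+1(G).
Proof. by move=> i0 lt_in; case/properP: (maxcl_lcn_proper i0 lt_in) => _ [y]; exists y. Qed.

(** A quotient of order at most [p] is abelian. If [G / N] has order [p ^ k] with [k > 1], its class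
    is at most [k.-1], so ['L_k(G) \subset N], and the orders agree. *)
Lemma maxcl_normal (N : {group gT}) : N <| G ->
  'L_2(G) \subset N \/ exists2 i, 1 < i <= n & N :=: 'L_i(G).
Proof.
move=> nsNG; have [sNG nNG] := andP nsNG; have pG := maxcl_pgroup.
have pGq : p.-group (G / N) by rewrite quotient_pgroup.
set k := logn p #|G / N|; have [le_k1|k_gt1] := leqP k 1.
  left; rewrite lcn2 der1_min // (p2group_abelian pGq) //.
  exact: leq_trans le_k1 _.
right; exists k.
  rewrite k_gt1 -maxcl_logn dvdn_leq_log // card_quotient //.
  exact: dvdn_indexg.
have sLN : 'L_k(G) \subset N.
  rewrite -quotient_sub1 ?(subset_trans (lcn_sub _ _)) // quotient_lcn //.
  have:= nil_class_pgroup pGq; rewrite -/k.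
  case: (k) k_gt1 => // m m_gt0; rewrite (maxn_idPr _) //.
  by move/(lcn_nil_classP _ (quotient_nil _ (pgroup_nil pG)))->.
apply/eqP; rewrite eq_sym eqEcard sLN /= maxcl_card_lcn //.
rewrite (card_pgroup (pgroupS sNG pG)) leq_exp2l ?prime_gt1 //.
rewrite /k card_quotient // -divgS // logn_div ?cardSg // maxcl_logn.
by rewrite subKn // -maxcl_logn dvdn_leq_log // cardSg.
Qed.

Lemma maxcl_normal_dich (N : {group gT}) i : 1 < i -> N <| G ->
  (N \subset 'L_i.+1(G)) || ('L_i(G) \subset N).
Proof.
move=> i_gt1 /maxcl_normal[sL2|[k /andP[k1 _] ->]].
  by rewrite (subset_trans _ sL2) ?orbT // lcn_sub_leq.
have [le_ki|lt_ik] := leqP k i; first by rewrite (lcn_sub_leq _ le_ki) orbT.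
by rewrite (lcn_sub_leq _ lt_ik).
Qed.

Lemma maxcl_normal_card (N : {group gT}) i : 1 < i <= n -> N <| G -> #|N| = (p ^ (n - i))%N ->
  N :=: 'L_i(G).
Proof.
case/andP=> i1 le_in nsNG oN.
have [sL2|[k /andP[k1 le_kn] defN]] := maxcl_normal nsNG; last first.
  move/eqP: oN; rewrite defN maxcl_card_lcn // eqn_exp2l ?prime_gt1 //.
  by rewrite eqn_sub2lE // => /eqP->.
have/subset_leq_card := sL2.
rewrite oN maxcl_card_lcn // leq_exp2l ?prime_gt1 // leq_sub2lE ?maxcl_gt1 // => i2.
apply/esym/eqP; rewrite eqEcard oN maxcl_card_lcn // leqnn andbT.
by apply: subset_trans sL2; apply: lcn_sub_leq.
Qed.
End MaximalClass.

(** * Powers of a product *)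

Section AbelianNormal.
Import GRing.Theory FiniteModule.

(** Written additively, conjugation by [s] acts on [A] as [1 + f] with [f y = [~ y, s]]. The
    correction to [s ^+ k] is the sum of the [(1 + f) ^ i] for [i < k] applied to [c], and its
    expansion in powers of [f] follows from Pascal's rule by induction on [k]. *)
Lemma expMg_abelian_normal (gT : finGroupType) (A : {group gT}) (s c : gT) k :
    abelian A -> s \in 'N(A) -> c \in A ->
  (s * c) ^+ k =
    s ^+ k * \prod_(j < k) iter j (fun y => [~ y, s]) c ^+ 'C(k, j.+1).
Proof.
move=> cAA nAs Ac; pose u := fmod cAA c.
pose f (v : fmod_of cAA) : fmod_of cAA := (v ^@ s - v)%R.
have fE v : val (f v) = [~ val v, s].
  rewrite /f addrC fmvalA fmvalN fmvalJ //.
have fD : {morph f : v w / (v + w)%R}.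
  by move=> v w; rewrite /f actAr opprD addrACA.
have f0 : (f 0 = 0)%R by rewrite /f act0r subrr.
have fM m : {morph f : v / (v *+ m)%R}.
  by move=> v; rewrite /f actZr mulrnBl.
have iterE j : iter j (fun y => [~ y, s]) c = val (iter j f u).
  by elim: j => [|j IHj]; rewrite ?fmodK //= IHj fE.
under eq_bigr => j _ do rewrite iterE -fmvalZ.
rewrite -fmval_sum.
elim: k => [|k IHk]; first by rewrite big_ord0 mulg1.
rewrite expgSr {}IHk; set S := (\sum_(i < k) _)%R.
transitivity (s ^+ k.+1 * fmval (S ^@ s + u)%R); last first.
  congr (_ * fmval _).
  have ->: (S ^@ s = S + f S)%R by rewrite /f addrC subrK.
  have -> : (f S = \sum_(i < k) iter i.+1 f u *+ 'C(k, i.+1))%R.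
    rewrite (big_morph f fD f0).
    by apply: eq_bigr => i _; rewrite fM.
  rewrite -addrA [(_ + u)%R]addrC.
  have -> : (u + \sum_(i < k) iter i.+1 f u *+ 'C(k, i.+1) =
             \sum_(i < k.+1) iter i f u *+ 'C(k, i))%R.
    by rewrite big_ord_recl bin0.
  have -> : (S = \sum_(i < k.+1) iter i f u *+ 'C(k, i.+1))%R.
    by rewrite big_ord_recr /= bin_small // addr0.
  by rewrite -big_split; apply: eq_bigr => i _; rewrite binS mulrnDr.
by rewrite fmvalA fmvalJ // fmodK // expgSr conjgE -!mulgA mulKVg.
Qed.

(** Here [s * [~ s, b] = s ^ b], whose [k]-th power is [(s ^+ k) ^ b = s ^+ k]. *)
Lemma prod_iter_commg_eq1 (gT : finGroupType) (A : {group gT}) (s b : gT) k :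
    abelian A -> s \in 'N(A) -> [~ s, b] \in A -> commute b (s ^+ k) ->
  \prod_(j < k) iter j (fun y => [~ y, s]) [~ s, b] ^+ 'C(k, j.+1) = 1.
Proof.
move=> cAA nAs Ac cbs; apply: (mulgI (s ^+ k)).
rewrite mulg1 -(expMg_abelian_normal k cAA nAs Ac).
by rewrite -conjg_mulR -conjXg /conjg -cbs mulKg.
Qed.
End AbelianNormal.

(** * Two-step centralizers *)

Lemma maxcl_quotient (gT : finGroupType) (p n l : nat) (G : {group gT}) :
  prime p -> maximal_class p n G -> 1 < l <= n -> maximal_class p l (G / 'L_l(G)).
Proof.
move=> p_pr maxG /andP[l_gt1 le_ln]; have nilG := pgroup_nil (maxcl_pgroup p_pr maxG).
have nN := lcn_norm l G; rewrite /maximal_class l_gt1 /=; apply/andP; split.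
  rewrite card_quotient // -divgS ?lcn_sub // (maxcl_card_lcn p_pr maxG) //.
  rewrite (maxcl_card maxG) -expnB ?subKn ?leq_subr //.
  exact: prime_gt0.
have nilQ := quotient_nil 'L_l(G) nilG.
have classE k : 0 < k -> (nil_class (G / 'L_l(G)) <= k.-1) = ('L_k(G) \subset 'L_l(G)).
  case: k => // k _; rewrite (sameP (lcn_nil_classP k nilQ) eqP).
  by rewrite -quotient_lcn // -quotient_sub1 ?subG1 // (subset_trans (lcn_sub _ _)).
apply/eqP; case: l l_gt1 le_ln nN nilQ classE => [|[|l]] // _ le_ln _ _ classE.
apply/eqP; rewrite eqn_leq (classE l.+2) // subxx ltnNge (classE l.+1) //.
by have /properP[_ [x Lx notLx]] := maxcl_lcn_proper p_pr maxG (isT : 0 < l.+1) le_ln;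
   apply: contra notLx => /subsetP->.
Qed.

(* P1 G is convertible to step_cent 2 G. *)
Definition step_cent (gT : finGroupType) (i : nat) (G : {group gT}) : {set gT} :=
  [set x in G | [forall y in 'L_i(G), [~ y, x] \in 'L_i.+2(G)]].

Lemma step_centP (gT : finGroupType) i (G : {group gT}) x :
  reflect (x \in G /\ {in 'L_i(G), forall y, [~ y, x] \in 'L_i.+2(G)})
          (x \in step_cent i G).
Proof.
rewrite inE; apply: (iffP andP) => -[Gx]; first by move/forall_inP.
by move=> cx; split=> //; apply/forall_inP.
Qed.

Lemma step_cent_group_set (gT : finGroupType) i (G : {group gT}) :
  group_set (step_cent i G).
Proof.
apply/group_setP; split.
  by apply/step_centP; split=> // y _; rewrite commg1 group1.
move=> x y /step_centP[Gx cx] /step_centP[Gy cy]; apply/step_centP.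
split=> [|z Lz]; first exact: groupM.
by rewrite commgMJ groupM ?cy // memJ_norm ?cx // (subsetP (lcn_norm _ _)).
Qed.
Canonical step_cent_group (gT : finGroupType) i (G : {group gT}) :=
  Group (step_cent_group_set i G).

Lemma step_cent_normal (gT : finGroupType) i (G : {group gT}) :
  step_cent i G <| G.
Proof.
apply/andP; split; first by apply/subsetP=> x /step_centP[].
apply/subsetP=> g Gg; rewrite inE; apply/subsetP=> _ /imsetP[x /step_centP[Gx cx] ->].
have nL k : g \in 'N('L_k(G)) by apply: subsetP Gg; apply: lcn_norm.
apply/step_centP; split=> [|y Ly]; first exact: groupJ.
have -> : [~ y, x ^ g] = [~ y ^ g^-1, x] ^ g by rewrite conjRg conjgKV.
by rewrite memJ_norm ?nL ?cx // memJ_norm // groupV nL.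
Qed.

Lemma lcn2_step_cent (gT : finGroupType) i (G : {group gT}) :
  0 < i -> 'L_2(G) \subset step_cent i G.
Proof.
move=> i_gt0; apply/subsetP=> x Lx; apply/step_centP.
split=> [|y Ly]; first by rewrite (subsetP (lcn_sub 2 G)).
by have /subsetP := lcn_comm G i_gt0 (isT : 0 < 2); rewrite addn2; apply; rewrite mem_commg.
Qed.

Lemma notin_step_cent (gT : finGroupType) i (G : {group gT}) s :
  s \in G -> s \notin step_cent i G -> 0 < i ->
  exists2 b, b \in 'L_i(G) & [~ b, s] \in 'L_i.+1(G) :\: 'L_i.+2(G).
Proof.
move=> Gs; rewrite inE Gs /= negb_forall_in => /exists_inP[b Lb nLbs] i_gt0.
exists b => //; rewrite inE nLbs.
by case: i i_gt0 Lb {nLbs} => // i _ Lb; rewrite lcnSn mem_commg.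
Qed.

(** * Elements outside several two-step centralizers, and exponents of abelian terms *)

Section MaximalClass.
Variables (gT : finGroupType) (p n : nat) (G : {group gT}).
Hypotheses (p_pr : prime p) (maxG : maximal_class p n G).

(** Otherwise ['L_i.+1(G) = [~: 'L_i(G), G]] would lie in ['L_i.+2(G)]. *)
Lemma maxcl_step_cent_proper i : 0 < i -> i.+1 < n -> step_cent i G \proper G.
Proof.
move=> i_gt0 lt_in; rewrite properE normal_sub ?step_cent_normal //=.
have /properP[_ [x Lx nLx]] := maxcl_lcn_proper p_pr maxG (isT : 0 < i.+1) lt_in.
apply: contra nLx => /subsetP sGC; apply: subsetP Lx.
case: i i_gt0 lt_in sGC => // i _ _ sGC; rewrite (lcnSn i) gen_subG.
by apply/subsetP=> _ /imset2P[y z Ly /sGC/step_centP[_ cz] ->]; apply: cz.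
Qed.

(** A proper subgroup of a [p]-group contains at most one [p]-th of its elements, so fewer than [p]
    of them cannot cover [G]. *)
Lemma maxcl_exists_uniform (r : seq nat) :
    size r < p -> {in r, forall i, 0 < i /\ i.+1 < n} ->
  exists2 s, s \in G & {in r, forall i, s \notin step_cent i G}.
Proof.
move=> lt_rp r_in; pose U := [set x in G | has (fun i => x \in step_cent i G) r].
suffices leU: #|U| * p <= size r * #|G|.
  have /subsetPn[s Gs] : ~~ (G \subset U).
    apply: contraL lt_rp => sGU; rewrite -leqNgt -(leq_pmul2l (cardG_gt0 G)).
    rewrite (mulnC _ (size r)); apply: leq_trans leU.
    by rewrite leq_mul2r subset_leq_card ?orbT.
  by rewrite inE Gs /= => /hasPn ns; exists s.
rewrite {}/U; elim: r {lt_rp} r_in => [_|i r IHr r_in].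
  rewrite (_ : [set x in G | _] = set0) ?cards0 //.
  by apply/setP=> x; rewrite !inE andbF.
have [i_gt0 lt_in] := r_in _ (mem_head i r).
have ltC := maxcl_step_cent_proper i_gt0 lt_in.
have pG := maxcl_pgroup p_pr maxG.
apply: leq_trans (_ : (#|step_cent i G| +
   #|[set x in G | has (fun i => x \in step_cent i G) r]|) * p <= _).
  rewrite leq_mul2r; apply/orP; right.
  rewrite -cardsUI; apply: leq_trans (leq_addr _ _); apply: subset_leq_card.
  apply/subsetP=> x /setIdP[Gx /= /orP[Cx|rx]]; rewrite in_setU ?Cx //.
  by rewrite [X in _ || X]inE Gx rx orbT.
rewrite mulnDl mulSn leq_add ?IHr //; last first.
  by move=> j rj; apply: r_in; rewrite inE rj orbT.
rewrite (card_pgroup (pgroupS (proper_sub ltC) pG)) (card_pgroup pG) -expnSr.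
by rewrite leq_exp2l ?prime_gt1 // (properG_ltn_log pG).
Qed.

Lemma maxcl_lcn_gen i y : 1 < i -> y \in 'L_i(G) -> y \notin 'L_i.+1(G) ->
  'L_i.+1(G) * <[y]> = 'L_i(G).
Proof.
move=> i_gt1 Ly nLy; have lt_in : i < n.
  rewrite ltnNge (maxcl_lcn1 p_pr maxG); apply: contra nLy => /eqP L1.
  by move: Ly; rewrite L1 => /set1P->.
rewrite (mulg_normal_maximal (lcn_normalS _ _)) ?cycle_subG //.
apply: p_index_maximal; first exact: lcn_subS.
rewrite -divgS ?lcn_subS // !(maxcl_card_lcn p_pr maxG) ?(leqW i_gt1) //.
rewrite -expnB ?prime_gt0 ?leq_sub2l // (_ : _ - _ = 1%N) ?expn1 //; lia.
Qed.

(** [G / 'L_2(G)] has order [p ^ 2], and it is not cyclic, as otherwise [G] would be cyclic. *)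
Lemma maxcl_expg_lcn2 s : 2 < n -> s \in G -> s ^+ p \in 'L_2(G).
Proof.
move=> n_gt2 Gs; have nG2 := lcn_norm 2 G; have pG := maxcl_pgroup p_pr maxG.
have oQ : #|G / 'L_2(G)| = (p ^ 2)%N.
  rewrite card_quotient // -divgS ?lcn_sub // (maxcl_card maxG).
  by rewrite (maxcl_card_lcn p_pr maxG) // -expnB ?subKn ?leq_subr ?prime_gt0 // ltnW.
have nQs : s \in 'N('L_2(G)) by apply: subsetP Gs.
apply: coset_idr; rewrite ?groupX // morphX //; apply/eqP; rewrite -order_dvdn.
have Qs := mem_quotient 'L_2(G) Gs; have := order_dvdG Qs; rewrite oQ.
case/(dvdn_pfactor _ _ p_pr) => k le_k2 oQs; rewrite oQs.
case: k le_k2 oQs => [|[|[|//]]] _ oQs; rewrite ?dvd1n ?dvdnn //.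
have cycQ : cyclic (G / 'L_2(G)).
  apply/cyclicP; exists (coset 'L_2(G) s); apply/eqP.
  by rewrite eq_sym eqEcard cycle_subG Qs -orderE oQs oQ /=.
have /cyclic_abelian/derG1P G1 : cyclic G.
  exact: cyclic_nilpotent_quo_der1_cyclic (pgroup_nil pG) cycQ.
by have := maxcl_lcn1 p_pr maxG 2; rewrite lcn2 G1 eqxx leqNgt n_gt2.
Qed.

(** Since [y] generates ['L_i(G)] modulo ['L_i.+1(G)], an [s] that centralizes [y] modulo
    ['L_i.+2(G)] centralizes the whole section. *)
Lemma maxcl_commg_notin i s y : 1 < i -> s \in G -> s \notin step_cent i G ->
  y \in 'L_i(G) -> y \notin 'L_i.+1(G) -> [~ y, s] \notin 'L_i.+2(G).
Proof.
move=> i_gt1 Gs ns Ly nLy; apply: contra ns => Lys; apply/step_centP; split=> // z.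
rewrite -(maxcl_lcn_gen i_gt1 Ly nLy) => /mulsgP[w _ Lw /cycleP[k ->] ->].
have nL g : g \in G -> g \in 'N('L_i.+2(G)) by apply/subsetP/lcn_norm.
have Gy : y \in G by rewrite (subsetP (lcn_sub i G)).
have Lyk m : [~ y ^+ m, s] \in 'L_i.+2(G).
  elim: m => [|m IHm]; first by rewrite comm1g group1.
  by rewrite expgS commMgJ groupM // memJ_norm // nL ?groupX.
rewrite commMgJ groupM // memJ_norm ?nL ?groupX //.
exact: (mem_commg Lw Gs).
Qed.

(** As [s] commutes with [s ^+ p], the preceding lemma keeps [s ^+ p] from lying in ['L_i(G)] but
    not in ['L_i.+1(G)] for each such [i]; it is pushed down one term at a time. *)
Lemma maxcl_expg_uniform s j : 2 < n -> s \in G ->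
    (forall i, 1 < i <= j -> s \notin step_cent i G) ->
  s ^+ p \in 'L_j.+1(G).
Proof.
move=> n_gt2 Gs; case: j => [_|j]; first by rewrite groupX.
elim: j => [_|j IHj ns]; first exact: maxcl_expg_lcn2.
have Lj : s ^+ p \in 'L_j.+2(G).
  by apply: IHj => i /andP[i1 ij]; apply: ns; rewrite i1 ltnW.
have [//|nLj] := boolP (s ^+ p \in 'L_j.+3(G)).
case/negP: (maxcl_commg_notin (isT : 1 < j.+2) Gs (ns j.+2 (leqnn _)) Lj nLj).
rewrite (_ : [~ _, _] = 1) ?group1 //.
by apply/eqP/commgP; apply: commute_sym; apply: commuteX.
Qed.

(* The p-th powers of A = 'L_m(G) are examined modulo [A^p, G], where those of
   'L_m.+1(G) vanish. *)
Lemma maxcl_lcn_exponent m : 1 < m -> abelian 'L_m(G) -> n < m + p ->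
  {in 'L_m(G), forall y, y ^+ p = 1}.
Proof.
move=> m_gt1 cAA lt_nmp; have pG := maxcl_pgroup p_pr maxG.
have [le_nm y|lt_mn] := leqP n m.
  by move: le_nm; rewrite (maxcl_lcn1 p_pr maxG) => /eqP-> /set1P->; rewrite expg1n.
(* The index [m.-1] yields [b] with [[~ s, b]] generating [A] modulo ['L_m.+1(G)]; the indices from
   2 to [n - m] push [s ^+ p] deep enough to commute with [b]. Together they number [n - m < p]. *)
pose r := m.-1 :: iota 2 (n - m).-1.
have szr : size r < p by rewrite /= size_iota; lia.
have rP i : i \in r -> 0 < i /\ i.+1 < n.
  by rewrite inE mem_iota => /orP[/eqP->|]; lia.
have rE i : 1 < i <= n - m -> i \in r.
  by rewrite inE mem_iota => i_in; apply/orP; right; lia.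
have n_gt2 : 2 < n by lia.
have m1_gt0 : 0 < m.-1 by lia.
have n_le j : p <= j.+1 -> n <= m + j by lia.
have m1E : m.-1.+1 = m by lia.
have mnE : m.-1 + (n - m).+1 = n by lia.
set A := 'L_m(G)%G; pose T := 'Mho^1(A)%G; pose R := [~: T, G]%G.
have pA : p.-group A := pgroupS (lcn_sub m G) pG.
have ET : T :=: [set x ^+ p | x in A] by rewrite /= (MhoEabelian 1 pA cAA) expn1.
have Tp x : x \in A -> x ^+ p \in T by move=> Ax; rewrite ET; apply: imset_f.
have nsTG : T <| G by rewrite gFnormal_trans ?lcn_normal.
have [sTG nTG] := andP nsTG.
have nRG : G \subset 'N(R) by rewrite commg_normr.
(* In a nilpotent group a nontrivial normal [T] is never contained in [[~: T, G]]. *)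
suffices sTR : T \subset R.
  have T1 : T :=: 1.
    apply: contraTeq sTR => ntT.
    have := @nil_comm_properl _ G T G (pgroup_nil pG) sTG ntT.
    by rewrite subsetI subxx nTG properE => /(_ isT)/andP[].
  by move=> y /Tp; rewrite T1 => /set1P.
have sRA : R \subset A.
  by rewrite (subset_trans _ (Mho_sub 1 A)) // commg_subl.
pose K := [set y in A | y ^+ p \in R].
have gK : group_set K.
  apply/group_setP; split; first by rewrite !inE expg1n !group1.
  move=> x y /setIdP[Ax Rx] /setIdP[Ay Ry]; rewrite inE groupM //.
  by rewrite expgMn ?groupM //; apply: (centsP cAA).
(* A generator [[~ a, g]] has [p]-th power [[~ a ^+ p, g]], because [A] is abelian. *)
have sLK : 'L_m.+1(G) \subset Group gK.
  case: (m) m_gt1 @A @T @R @K cAA {lt_nmp lt_mn pA} ET Tp nsTG sTG nTG nRG sRA gK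
    => // k _ A T R K cAA ET Tp nsTG sTG nTG nRG sRA gK.
  rewrite lcnSn gen_subG; apply/subsetP=> _ /imset2P[a g Aa Gg ->].
  have Aag : a ^ g \in A by rewrite memJ_norm // (subsetP (lcn_norm _ G)).
  rewrite inE commgEl groupM ?groupV //= expgMn; last first.
    by apply: (centsP cAA); rewrite ?groupV.
  by rewrite expgVn -conjXg -commgEl mem_commg // Tp.
have [s Gs ns] := maxcl_exists_uniform szr rP.
have [b Lb] := notin_step_cent Gs (ns _ (mem_head _ _)) m1_gt0; rewrite m1E.
rewrite in_setD => /andP[nLbs Abs].
have Lsp : s ^+ p \in 'L_(n - m).+1(G).
  by apply: maxcl_expg_uniform => // i /rE; apply: ns.
have Gb : b \in G by rewrite (subsetP (lcn_sub m.-1 G)).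
have cbs : commute b (s ^+ p).
  apply/commgP; rewrite -in_set1; have Ln1 : 'L_n(G) = 1.
    by apply/eqP; rewrite -(maxcl_lcn1 p_pr maxG).
  rewrite -[[set 1]]Ln1.
  have /subsetP := @lcn_comm _ G m.-1 (n - m).+1 m1_gt0 isT.
  by rewrite mnE; apply; rewrite mem_commg.
set c := [~ s, b]; have Ac : c \in A by rewrite -groupV invg_comm.
have nAs : s \in 'N(A) by rewrite (subsetP (lcn_norm m G)).
have prod1 q : q = p ->
    \prod_(j < q) iter j (fun y => [~ y, s]) c ^+ 'C(p, j.+1) = 1.
  by move=> ->; apply: prod_iter_commg_eq1 cAA nAs Ac cbs.
have Li j : iter j (fun y => [~ y, s]) c \in 'L_(m + j)(G).
  elim: j => [|j IHj]; first by rewrite addn0.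
  by rewrite addnS /=; case: (m + j) (IHj) (ltn_addr j m_gt1) => // k Lk _; rewrite lcnSn mem_commg.
(* For [j.+1 < p] the binomial is divisible by [p] and the iterated commutator lies in [K]; for
   larger [j] that commutator lies in ['L_(m + j)(G) = 1]. *)
have Rj j : 0 < j -> iter j (fun y => [~ y, s]) c ^+ 'C(p, j.+1) \in R.
  move=> j_gt0; have [lt_jp | le_pj] := ltnP j.+1 p; last first.
    have /eqP Lmj : 'L_(m + j)(G) == 1 by rewrite -(maxcl_lcn1 p_pr maxG) n_le.
    by move: (Li j); rewrite Lmj => /set1P->; rewrite expg1n group1.
  have /dvdnP[q ->] : p %| 'C(p, j.+1) by rewrite prime_dvd_bin.
  have : iter j (fun y => [~ y, s]) c \in Group gK.
    apply: (subsetP sLK); apply: subsetP (Li j); apply: lcn_sub_leq.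
    by rewrite -addn1 leq_add2l.
  by rewrite inE mulnC expgM => /andP[_]; apply: groupX.
(* The factor with [j = 0] is [c ^+ p]; all the others are in [R] and the product is 1. *)
have Kc : c \in K.
  rewrite inE Ac /=; have [p1 pE] : exists p1, p = p1.+1.
    by exists p.-1; rewrite prednK ?prime_gt0.
  move: (prod1 _ (esym pE)); rewrite big_ord_recl /= bin1 => /(canRL (mulgK _)) ->.
  by rewrite mul1g groupV group_prod // => i _; apply: Rj.
have sAK : A \subset Group gK.
  rewrite -[gval A](@maxcl_lcn_gen m c) ?mul_subG ?cycle_subG //.
  by rewrite -groupV invg_comm.
rewrite ET; apply/subsetP=> _ /imsetP[y /(subsetP sAK)] + ->.
by rewrite inE => /andP[].
Qed.
End MaximalClass.

(** * Generators of G, and p-th powers when the order is p^(p + 2) *)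

Section MaximalClass.
Variables (gT : finGroupType) (p n : nat) (G : {group gT}).
Hypotheses (p_pr : prime p) (maxG : maximal_class p n G).
Let pG := maxcl_pgroup p_pr maxG.

Lemma maxcl_sub_Phi : 'L_2(G) \subset 'Phi(G).
Proof. by rewrite (Phi_joing pG) lcn2 joing_subl. Qed.

Lemma maxcl_gen2 (M : {group gT}) b s : M \proper G -> 'L_2(G) \subset M ->
    b \in M -> b \notin 'L_2(G) -> s \in G -> s \notin M ->
  <<[set b; s]>> = G.
Proof.
move=> ltMG sLM Mb nLb Gs nMs; have sMG := proper_sub ltMG.
have Gb := subsetP sMG _ Mb.
pose K := ('L_2(G) <*> [set b; s])%G.
have sKG : K \subset G.
  by rewrite join_subG lcn_sub /= subUset !sub1set Gb Gs.
have Kb : b \in K by rewrite mem_gen // !inE eqxx orbT.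
have Ks : s \in K by rewrite mem_gen // !inE eqxx !orbT.
have sLK : 'L_2(G) \subset K by rewrite joing_subl.
have pK := pgroupS sKG pG.
have lt1 : 'L_2(G) \proper K :&: M.
  rewrite properE subsetI sLK sLM /=; apply: contra nLb => /subsetP; apply.
  by rewrite inE Kb Mb.
have lt2 : K :&: M \proper K.
  rewrite properE subsetIl /=; apply: contra nMs => /subsetP/(_ s Ks).
  by rewrite inE => /andP[].
have log1 := properG_ltn_log (pgroupS (subsetIl K M) pK) lt1.
have log2 := properG_ltn_log pK lt2.
rewrite (maxcl_logn_lcn p_pr maxG) // in log1.
have defK : K :=: G.
  apply/eqP; rewrite eqEcard sKG (card_pgroup pG) (card_pgroup pK).
  rewrite leq_exp2l ?prime_gt1 // (maxcl_logn p_pr maxG).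
  apply: leq_trans (leq_ltn_trans log1 log2).
  by rewrite -addn2 subnK ?(maxcl_gt1 maxG).
apply: Phi_nongen; apply/eqP; rewrite eqEsubset join_subG Phi_sub /=.
rewrite subUset !sub1set Gb Gs /= -{1}defK genS // setSU //.
exact: maxcl_sub_Phi.
Qed.

(** Otherwise the generators [b] and [s] commute modulo ['L_3(G)], and [G / 'L_3(G)] is abelian. *)
Lemma maxcl_commg_notin3 (M : {group gT}) b s : 2 < n -> M \proper G ->
    'L_2(G) \subset M -> b \in M -> b \notin 'L_2(G) -> s \in G -> s \notin M ->
  [~ b, s] \notin 'L_3(G).
Proof.
move=> n_gt2 ltMG sLM Mb nLb Gs nMs; apply/negP => Lbs.
have genG := maxcl_gen2 ltMG sLM Mb nLb Gs nMs.
have nG3 := lcn_norm 3 G; have Gb := subsetP (proper_sub ltMG) _ Mb.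
have [nb ns] : b \in 'N('L_3(G)) /\ s \in 'N('L_3(G)) by rewrite !(subsetP nG3).
have cbs : commute (coset 'L_3(G) b) (coset 'L_3(G) s).
  by apply/commgP; rewrite -morphR //=; apply/eqP/coset_id.
have cGG : abelian (G / 'L_3(G)).
  have -> : G / 'L_3(G) = <<[set b; s] / 'L_3(G)>>.
    by rewrite -quotient_gen ?genG // subUset !sub1set nb ns.
  rewrite abelian_gen.
  rewrite quotientU !quotient_set1 // /abelian subUset centU !subsetI.
  rewrite !sub1set !cent_set1 !cent1id /= andbT [X in _ && X]cent1C andbb.
  exact/cent1P.
have := der1_min nG3 cGG; rewrite -lcn2 => sL23.
have := maxcl_lcn_proper p_pr maxG (isT : 0 < 2) n_gt2.
by rewrite properE sL23 andbF.
Qed.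

(** [[~: 'L_3(G), 'L_2(G)]] lies in ['L_5(G) = 1], so ['L_2(G)] is cyclic over a central
    subgroup. *)
Lemma maxcl_lcn2_abelian : n <= 5 -> abelian 'L_2(G).
Proof.
move=> n_le5.
have sLZ : 'L_3(G) \subset 'Z('L_2(G)).
  rewrite subsetI lcn_subS /=; apply/commG1P/trivgP.
  have /eqP <- : 'L_5(G) == 1 by rewrite -(maxcl_lcn1 p_pr maxG).
  exact: (@lcn_comm _ G 3 2).
apply: cyclic_factor_abelian sLZ _; apply: (dvdn_prime_cyclic p_pr).
rewrite card_quotient ?(subset_trans (lcn_sub _ _)) ?lcn_norm //.
rewrite -divgS ?lcn_subS // !(maxcl_card_lcn p_pr maxG) //.
rewrite -expnB ?prime_gt0 ?leq_sub2l // -{2}(expn1 p) dvdn_exp2l //; lia.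
Qed.

(** This is the first order for which the exponent bound fails for ['L_2(G)]. In the product formula
    the middle factors vanish since ['L_3(G)] has exponent dividing [p], and the last factor is a
    nontrivial element of ['L_p.+1(G)], so the first factor [[~ s, b] ^+ p] is nontrivial. *)
Lemma maxcl_expg_lcn2_neq1 c : n = p.+2 -> abelian 'L_2(G) ->
  c \in 'L_2(G) -> c \notin 'L_3(G) -> c ^+ p != 1.
Proof.
move=> nE cAA Lc nLc; have p_gt1 := prime_gt1 p_pr.
have n_gt2 : 2 < n by rewrite nE !ltnS ltnW.
have sL32 : 'L_3(G) \subset 'L_2(G) by rewrite lcn_subS.
have L3p : {in 'L_3(G), forall y, y ^+ p = 1}.
  apply: (maxcl_lcn_exponent p_pr maxG) => //; first exact: abelianS cAA.
  by rewrite nE.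
have L1 k : n <= k -> 'L_k(G) = 1 by rewrite (maxcl_lcn1 p_pr maxG) => /eqP.
pose r := iota 2 p.-1.
have szr : size r < p by rewrite size_iota prednK ?prime_gt0.
have rP i : i \in r -> 0 < i /\ i.+1 < n by rewrite mem_iota; lia.
have rE i : 1 < i <= p -> i \in r by rewrite mem_iota; lia.
have [s Gs ns] := maxcl_exists_uniform p_pr maxG szr rP.
have n2s : s \notin step_cent 2 G by apply: ns; apply: rE.
have nLs : s \notin 'L_2(G).
  by apply: contra n2s; apply: (subsetP (lcn2_step_cent G (isT : 0 < 2))).
have Lsp : s ^+ p \in 'L_p.+1(G).
  by apply: (maxcl_expg_uniform p_pr maxG) => // i /rE; apply: ns.
(* [M] is proper, as otherwise [s] would generate [G] modulo its Frattini subgroup. Any [b] outside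
   [M] then gives [[~ s, b]] outside ['L_3(G)]. *)
pose M := ('L_2(G) <*> <[s]>)%G.
have ltMG : M \proper G.
  rewrite properE join_subG lcn_sub cycle_subG Gs /=; apply/negP => sGM.
  have /cyclic_abelian/derG1P G1 : cyclic G.
    apply/cyclicP; exists s; apply/esym/(Phi_nongen (G := G) (X := [set s])).
    apply/eqP; rewrite eqEsubset join_subG Phi_sub sub1set Gs /=.
    apply: subset_trans sGM _; rewrite join_subG cycle_subG.
    by rewrite (subset_trans maxcl_sub_Phi) ?joing_subl // mem_gen // !inE eqxx orbT.
  by have := maxcl_lcn1 p_pr maxG 2; rewrite lcn2 G1 eqxx leqNgt n_gt2.
have [b Gb nMb] : exists2 b, b \in G & b \notin M.
  by case/properP: ltMG => _ [b]; exists b.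
have n3sb : [~ s, b] \notin 'L_3(G).
  apply: maxcl_commg_notin3 nMb => //; first exact: joing_subl.
  by rewrite mem_gen // inE cycle_id orbT.
have L2sb : [~ s, b] \in 'L_2(G) by rewrite lcnSn mem_commg.
have cbs : commute b (s ^+ p).
  apply/commgP; rewrite -in_set1 -[[set 1]](L1 p.+2) ?nE // lcnSn commGC.
  by rewrite mem_commg.
have nAs : s \in 'N('L_2(G)) by rewrite (subsetP (lcn_norm 2 G)).
have prod1 := prod_iter_commg_eq1 cAA nAs L2sb cbs.
pose f y := [~ y, s].
have fP j : j < p -> iter j f [~ s, b] \in 'L_j.+2(G) :\: 'L_j.+3(G).
  elim: j => [_|j IHj lt_jp]; first by rewrite in_setD n3sb.
  have := IHj (ltnW lt_jp); rewrite !in_setD => /andP[nLj Lj].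
  rewrite (maxcl_commg_notin p_pr maxG) //; last by apply: ns; apply: rE.
  exact: (mem_commg Lj Gs).
have csb : [~ s, b] ^+ p != 1.
  apply/eqP => csb1; have [p1 pE] : exists p1, p = p1.+1.
    by exists p.-1; rewrite prednK ?prime_gt0.
  have := fP p1; rewrite -pE leqnn => /(_ isT)/setDP[_].
  rewrite L1 ?nE ?pE // => /set1P; apply.
  have prodq q : q = p ->
    \prod_(j < q) iter j f [~ s, b] ^+ 'C(q, j.+1) = 1 by move=> ->.
  move: (prodq _ (esym pE)); rewrite big_ord_recr /= binn expg1 big1 ?mul1g //.
  move=> i _; have /dvdnP[q ->] : p1.+1 %| 'C(p1.+1, i.+1).
    by rewrite prime_dvd_bin -?pE //= pE ltnS.
  rewrite mulnC expgM -pE; case: i => [[|i] lt_ip]; first by rewrite csb1 expg1n.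
  rewrite L3p ?expg1n //; have /fP/setDP[Li _] : i.+1 < p by rewrite pE ltnW.
  by apply: subsetP Li; apply: lcn_sub_leq.
(* Both [c] and [[~ s, b]] generate ['L_2(G)] modulo ['L_3(G)], whose [p]-th powers are trivial, so
   the result transfers to [c]. *)
apply: contra csb => /eqP c1; move: L2sb.
rewrite -(maxcl_lcn_gen p_pr maxG (isT : 1 < 2) Lc nLc) => /mulsgP[w _ Lw /cycleP[k ->] ->].
rewrite expgMn; last by apply: (centsP cAA); rewrite ?groupX // (subsetP sL32).
by rewrite L3p // mul1g -expgM mulnC expgM c1 expg1n.
Qed.

(** If [b ^+ p] were in ['L_p.+1(G)] it would be central, so that [(b * [~ b, s]) ^+ p = b ^+ p]. As
    [n <= 5], [[~ [~ b, s], b]] is central and the class 2 power formula leaves [[~ b, s] ^+ p = 1],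
    against the preceding lemma. *)
Lemma maxcl_expg_step_cent2 b : p <= 3 -> n = p.+2 ->
  b \in step_cent 2 G -> b \notin 'L_2(G) -> b ^+ p \notin 'L_p.+1(G).
Proof.
move=> p_le3 nE Cb nLb; have p_gt1 := prime_gt1 p_pr.
have n_gt2 : 2 < n by rewrite nE !ltnS ltnW.
have cAA : abelian 'L_2(G) by rewrite maxcl_lcn2_abelian // nE.
have L1 k : n <= k -> 'L_k(G) = 1 by rewrite (maxcl_lcn1 p_pr maxG) => /eqP.
have ltCG : step_cent 2 G \proper G by rewrite (maxcl_step_cent_proper p_pr maxG) // nE.
have /properP[sCG [s Gs nCs]] := ltCG; have Gb := subsetP sCG b Cb.
have sLC := lcn2_step_cent G (isT : 0 < 2).
have n3bs : [~ b, s] \notin 'L_3(G).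
  by exact: (@maxcl_commg_notin3 (step_cent_group 2 G)).
have Lbs : [~ b, s] \in 'L_2(G) by rewrite lcnSn mem_commg.
have := maxcl_expg_lcn2_neq1 nE cAA Lbs n3bs; apply: contra => Lbp.
have cbps : commute (b ^+ p) s.
  by apply/commgP; rewrite -in_set1 -[[set 1]](L1 p.+2) ?nE // lcnSn mem_commg.
set c := [~ b, s] in Lbs n3bs *.
have Lcb : [~ c, b] \in 'L_4(G) by case/step_centP: Cb => _; apply.
have cL4 x : x \in G -> commute x [~ c, b].
  move=> Gx; apply/commgP; rewrite -in_set1 -[[set 1]](L1 5) ?nE // lcnSn commGC.
  by rewrite mem_commg.
have Gc : c \in G by rewrite (subsetP (lcn_sub 2 G)).
(* For [p = 2] the commutator is in ['L_4(G) = 1]; for [p = 3] the binomial is [p] and ['L_3(G)] has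
   exponent dividing [p]. *)
have bin1 : [~ c, b] ^+ 'C(p, 2) = 1.
  have: (p == 2) || (p == 3) by move: p_gt1 p_le3; case: (p) => [|[|[|[|q]]]].
  case/orP=> /eqP pE; first by move: Lcb; rewrite L1 ?nE ?pE // => /set1P->; rewrite expg1n.
  have -> : 'C(p, 2) = p by rewrite pE.
  apply: (maxcl_lcn_exponent p_pr maxG (isT : 1 < 3)); first exact: abelianS (lcn_subS 2 G) cAA.
    by rewrite nE.
  by apply: subsetP Lcb; apply: lcn_sub_leq.
have := expMg_Rmul p (cL4 c Gc) (cL4 b Gb); rewrite bin1 mulg1 -conjg_mulR -conjXg.
rewrite /conjg cbps mulKg => e.
by apply/eqP/(mulgI (b ^+ p)); rewrite -e mulg1.
Qed.
End MaximalClass.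

(** * Centralizers of nonabelian subgroups *)

Lemma mulg_index_prime (gT : finGroupType) (p : nat) (G M : {group gT}) s :
    p.-group G -> prime p -> M \subset G -> #|G : M| = p -> s \in G -> s \notin M ->
  M * <[s]> = G.
Proof.
move=> pG p_pr sMG iMG Gs nMs.
have maxM : maximal M G by apply: p_index_maximal; rewrite // iMG.
by rewrite (mulg_normal_maximal (p_maximal_normal pG maxM)) ?cycle_subG.
Qed.

(** Centralizers of elements outside [M] have order at most [p ^ 2], hence are abelian and cannot
    contain [H]; so ['C_G(H)] lies in [M], and then in ['Z(G)]. The nontrivial group ['Z(H)] lies in
    ['Z(G)], of prime order, so the two are equal. *)
Lemma cent_sub_not_sub_maximal (gT : finGroupType) (p : nat) (G M H : {group gT}) :
    p.-group G -> #|'Z(G)| = p -> M \subset G -> #|G : M| = p ->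
    (forall s, s \in G -> s \notin M -> 'C_M[s] \subset 'Z(G)) ->
    H \subset G -> ~~ abelian H -> ~~ (H \subset M) ->
  'C_G(H) \subset H.
Proof.
move=> pG oZ sMG iMG sCZ sHG nabH /subsetPn[s Hs nMs].
have ntH : H :!=: 1 by apply: contraNneq nabH => ->; apply: abelian1.
have [p_pr _ _] := pgroup_pdiv (pgroupS sHG pG) ntH.
have abC c : c \in G -> c \notin M -> abelian 'C_G[c].
  move=> Gc nMc; have pC : p.-group 'C_G[c] := pgroupS (subsetIl _ _) pG.
  apply: (p2group_abelian pC); rewrite -(@pfactorK p 2) //.
  rewrite dvdn_leq_log ?expn_gt0 ?prime_gt0 //.
  have leC : #|'C_G[c]| <= p ^ 2.
    rewrite -(leq_pmul2r (cardG_gt0 M)) mul_cardG.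
    have -> : (p ^ 2 * #|M| = #|G| * p)%N.
      by rewrite -(Lagrange sMG) iMG -mulnA mulnn mulnC.
    apply: leq_mul; first by rewrite subset_leq_card // mul_subG ?subsetIl.
    rewrite -oZ subset_leq_card //; apply: subset_trans (sCZ c Gc nMc).
    by rewrite setIAC subsetI subsetIr (subset_trans (subsetIl _ _)) ?subsetIr.
  rewrite (card_pgroup pC) dvdn_exp2l // -(leq_exp2l _ _ (prime_gt1 p_pr)).
  by rewrite -card_pgroup.
have sCM : 'C_G(H) \subset M.
  apply/subsetP=> c /setIP[Gc cHc]; apply: contraR nabH => nMc.
  by apply: abelianS (abC c Gc nMc); rewrite subsetI sHG sub_cent1.
have sCZG : 'C_G(H) \subset 'Z(G).
  apply: subset_trans (sCZ s (subsetP sHG s Hs) nMs).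
  by rewrite subsetI sCM (subset_trans (subsetIr _ _)) // -cent_set1 centS ?sub1set.
have sZHZ : 'Z(H) \subset 'Z(G).
  by apply: subset_trans sCZG; rewrite setSI.
have ntZH : 'Z(H) != 1 by rewrite (center_nil_eq1 (pgroup_nil (pgroupS sHG pG))).
have eqZ : 'Z(G) = 'Z(H).
  apply/eqP; rewrite eq_sym eqEsubset sZHZ /=; apply/setIidPl; apply: contraNeq ntZH => ZHneq.
  rewrite -(setIidPr sZHZ); apply/eqP; apply: prime_TIg; rewrite ?oZ //.
  by apply: contra ZHneq => /setIidPl/eqP.
by rewrite (subset_trans sCZG) // eqZ center_sub.
Qed.

(** An element of [M] centralizing some [s] outside [M] centralizes [M * <[s]> = G]. *)
Lemma selfcentralizing_abelian_maximal (gT : finGroupType) (p : nat) (G M : {group gT}) :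
    p.-group G -> #|'Z(G)| = p -> M \subset G -> #|G : M| = p -> abelian M ->
  nonabelian_selfcentralizing G.
Proof.
move=> pG oZ sMG iMG cMM H sHG nabH.
have [sHM|] := boolP (H \subset M); first by rewrite (abelianS sHM) in nabH.
apply: (cent_sub_not_sub_maximal pG oZ sMG iMG _ sHG nabH) => // s Gs nMs.
have ntG : G :!=: 1 by apply: contraNneq nMs => G1; move: Gs; rewrite G1 => /set1P->; apply: group1.
have [p_pr _ _] := pgroup_pdiv pG ntG.
apply/subsetP=> x /subcent1P[Mx csx]; rewrite inE (subsetP sMG) //= -sub_cent1.
rewrite -(mulg_index_prime pG p_pr sMG iMG Gs nMs) mul_subG //.
  by rewrite sub_cent1 (subsetP cMM).
by rewrite cycle_subG cent1C; apply/cent1P.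
Qed.

(** * The centre, the index of P1, and the case of an abelian P1 *)

Section MaximalClass.
Variables (gT : finGroupType) (p n : nat) (G : {group gT}).
Hypotheses (p_pr : prime p) (maxG : maximal_class p n G).
Let pG := maxcl_pgroup p_pr maxG.

(** If the centre is a term ['L_i(G)], it is nontrivial with ['L_i.+1(G) = 1], which forces
    [i = n.-1]. If it contains ['L_2(G)], the class is 2 and [G] is extraspecial of order
    [p ^ 3]. *)
Lemma maxcl_card_center : 2 < n -> #|'Z(G)| = p.
Proof.
move=> n_gt2; have n_gt1 := ltnW n_gt2.
have L1 k : (n <= k) = ('L_k(G) == 1) := maxcl_lcn1 p_pr maxG k.
have nabG : ~~ abelian G.
  by apply: contraL n_gt2 => /derG1P; rewrite -leqNgt L1 lcn2 => ->.
have [sLZ|[i /andP[i_gt1 le_in] defZ]] := maxcl_normal p_pr maxG (center_normal G).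
  apply: (card_center_extraspecial pG); apply: (p3group_extraspecial pG) => //.
  rewrite (maxcl_logn p_pr maxG) L1 lcnSn; apply/eqP/commG1P.
  by apply: subset_trans sLZ _; apply: subsetIr.
have lt_in : i < n.
  rewrite ltnNge L1 -defZ (center_nil_eq1 (pgroup_nil pG)).
  by apply: contra nabG => /eqP->; apply: abelian1.
have le_ni1 : n <= i.+1.
  rewrite L1; case: (i) i_gt1 defZ => // k _ defZ; rewrite lcnSn -defZ.
  by apply/eqP/commG1P; apply: subsetIr.
rewrite defZ (maxcl_card_lcn p_pr maxG) //.
have -> : n = i.+1 by apply/eqP; rewrite eqn_leq le_ni1.
by rewrite subSnn expn1.
Qed.

(** Centralizing one [y] in ['L_2(G)] but not in ['L_3(G)] modulo ['L_4(G)] is enough to lie in [C],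
    and the conjugates of [y] in [G / 'L_4(G)] fill at most a coset of ['L_3(G) / 'L_4(G)], of order
    [p]. *)
Lemma maxcl_index_step_cent2 : 3 < n -> #|G : step_cent 2 G| = p.
Proof.
move=> n_gt3; have nE : n - 3 - (n - 4) = 1%N by lia.
have n_gt2 := ltnW n_gt3; set C := step_cent_group 2 G.
have /andP[sCG nCG] : C <| G := step_cent_normal 2 G.
have ltCG : C \proper G by apply: (maxcl_step_cent_proper p_pr maxG).
have /properP[_ [y Ly nLy]] := maxcl_lcn_proper p_pr maxG (isT : 0 < 2) n_gt2.
pose N := 'L_4(G)%G; have nG4 : G \subset 'N(N) := lcn_norm 4 G.
have sNC : N \subset C.
  by apply: subset_trans (lcn2_step_cent G (isT : 0 < 2)); apply: lcn_sub_leq.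
have Gy : y \in G := subsetP (lcn_sub 2 G) y Ly.
have sCC : 'C_(G / N)[coset N y] \subset C / N.
  apply/subsetP=> xb /setIP[/morphimP[x nNx Gx ->]] /cent1P cxy.
  apply: mem_quotient; apply: contraT => nCx.
  case/negP: (maxcl_commg_notin p_pr maxG (isT : 1 < 2) Gx nCx Ly nLy).
  apply: coset_idr; first by rewrite (subsetP nG4) // groupR.
  by rewrite morphR ?(subsetP nG4) //; apply/eqP/commgP; apply: commute_sym.
have le_ip : #|G : C| <= p.
  rewrite -(index_quotient_eq _ sCG nG4) ?subIset ?sNC ?orbT //.
  apply: leq_trans (dvdn_leq (indexg_gt0 _ _) (indexgS (G / N) sCC)) _; rewrite index_cent1.
  have sub : coset N y ^: (G / N) \subset coset N y *: ('L_3(G) / N).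
    apply/subsetP=> _ /imsetP[_ /morphimP[x nNx Gx ->] ->].
    rewrite mem_lcoset -commgEl -morphR ?(subsetP nG4) // mem_quotient //.
    exact: (mem_commg Ly Gx).
  apply: leq_trans (subset_leq_card sub) _.
  rewrite card_lcoset card_quotient ?(subset_trans (lcn_sub _ _)) //.
  rewrite -divgS ?lcn_subS // !(maxcl_card_lcn p_pr maxG) //.
  by rewrite -expnB ?prime_gt0 ?leq_sub2l // nE expn1.
have /p_natP[k ik] : p.-nat #|G : C| := pnat_dvd (dvdn_indexg _ _) pG.
rewrite /= in ik; rewrite ik in le_ip *; have p_gt1 := prime_gt1 p_pr.
case: k ik le_ip => [|[|k]] ik; rewrite ?expn1 //.
  by move/eqP: ik; rewrite expn0 indexg_eq1 => sGC; rewrite properE sGC andbF in ltCG.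
by rewrite -{2}(expn1 p) leq_exp2l.
Qed.
End MaximalClass.

(** A group of order [p ^ 3] has a subgroup of order [p ^ 2], which is abelian and maximal. *)
Lemma maxcl_le3_selfcentralizing (gT : finGroupType) (p n : nat) (G : {group gT}) :
  prime p -> maximal_class p n G -> n <= 3 -> nonabelian_selfcentralizing G.
Proof.
move=> p_pr maxG n_le3; have pG := maxcl_pgroup p_pr maxG.
have [n_le2|n_gt2] := leqP n 2.
  move=> H sHG; have abG : abelian G.
    by apply: (p2group_abelian pG); rewrite (maxcl_logn p_pr maxG).
  by rewrite (abelianS sHG).
have n3 : n = 3 by apply/eqP; rewrite eqn_leq n_le3.
have [M [sMG _ oM]] : exists Q : {group gT}, [/\ Q \subset G, Q <| G & #|Q| = (p ^ 2)%N].
  by apply: normal_pgroup; rewrite // (maxcl_logn p_pr maxG) n3.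
apply: (selfcentralizing_abelian_maximal pG (maxcl_card_center p_pr maxG n_gt2) sMG).
  rewrite -divgS // oM (maxcl_card maxG) n3 -expnB ?prime_gt0 //.
exact: card_p2group_abelian oM.
Qed.

Lemma maxcl_P1_abelian_selfcentralizing (gT : finGroupType) (p n : nat) (G : {group gT}) :
  prime p -> maximal_class p n G -> 3 < n -> abelian (P1 G) ->
  nonabelian_selfcentralizing G.
Proof.
move=> p_pr maxG n_gt3 abP1; have pG := maxcl_pgroup p_pr maxG.
apply: (@selfcentralizing_abelian_maximal _ p G (step_cent_group 2 G)) => //.
- exact: maxcl_card_center (ltnW n_gt3).
- by rewrite normal_sub ?step_cent_normal.
exact: (maxcl_index_step_cent2 p_pr maxG).
Qed.

(** * The primes 2 and 3 *)

Section MaximalClass.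
Variables (gT : finGroupType) (p n : nat) (G : {group gT}).
Hypotheses (p_pr : prime p) (maxG : maximal_class p n G).
Let pG := maxcl_pgroup p_pr maxG.

(** Reduction to [G / 'L_p.+2(G)], of maximal class and order [p ^ p.+2]. *)
Lemma maxcl_expg_P1 b : p <= 3 -> p.+2 <= n ->
  b \in step_cent 2 G -> b \notin 'L_2(G) -> b ^+ p \notin 'L_p.+1(G).
Proof.
move=> p_le3 le_pn /step_centP[Gb Cb] nLb; have p_gt1 := prime_gt1 p_pr.
have le4p : 4 <= p.+2 by rewrite !ltnS.
pose N := 'L_p.+2(G)%G; have nGN : G \subset 'N(N) := lcn_norm _ G.
have maxQ : maximal_class p p.+2 (G / N).
  by apply: (maxcl_quotient p_pr maxG); rewrite le_pn.
have nNb : b \in 'N(N) by rewrite (subsetP nGN).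
have Ncoset k x : k <= p.+2 -> x \in G ->
    (coset N x \in 'L_k(G / N)) = (x \in 'L_k(G)).
  move=> le_k Gx; rewrite -quotient_lcn //.
  have sNL : N \subset 'L_k(G) by apply: lcn_sub_leq.
  apply/idP/idP=> [|Lx]; last exact: (mem_quotient N Lx).
  case/morphimP=> y nNy Ly /(kercoset_rcoset (subsetP nGN x Gx) nNy)[z Nz ->].
  by rewrite groupM // (subsetP sNL).
have : (coset N b) ^+ p \notin 'L_p.+1(G / N).
  apply: (maxcl_expg_step_cent2 p_pr maxQ) => //; last by rewrite Ncoset.
  apply/step_centP; split=> [|yb]; first exact: mem_quotient.
  rewrite -quotient_lcn // => /morphimP[y nNy Ly ->].
  have Gy : y \in G := subsetP (lcn_sub 2 G) y Ly.
  by rewrite -morphR // Ncoset ?Cb ?groupR.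
have <- : coset N (b ^+ p) = coset N b ^+ p by rewrite morphX.
by rewrite (Ncoset _ _ (leqnSn _) (groupX p Gb)).
Qed.

(** In [G / 'L_i.+2(G)] the image of ['L_i(G)] is abelian because [i.+2 <= i + i], and its order
    [p ^ 2] is less than [p ^ p] for odd [p], so the exponent bound applies. If [n < i.+2], it
    applies to [G] itself. *)
Lemma maxcl_lcn_expg i y : odd p -> 1 < i -> y \in 'L_i(G) -> y ^+ p \in 'L_i.+2(G).
Proof.
move=> odd_p i_gt1 Ly; have p_gt2 := odd_prime_gt2 odd_p p_pr.
have abL (hT : finGroupType) (H : {group hT}) k : 'L_k(H) = 1 -> k <= i + i -> abelian 'L_i(H).
  move=> Lk1 le_k; apply/commG1P/trivgP; rewrite -Lk1.
  by apply: subset_trans (lcn_comm H _ _) (lcn_sub_leq _ _); rewrite ?(ltnW i_gt1).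
have lt_iip : i.+2 < i + p by rewrite -addn2 ltn_add2l.
have le_ii : i.+2 <= i + i by rewrite -addn2 leq_add2l.
have [le_in|lt_ni] := leqP i.+2 n; last first.
  have Ln1 : 'L_n(G) = 1 by apply/eqP; rewrite -(maxcl_lcn1 p_pr maxG).
  have -> : y ^+ p = 1; last exact: group1.
  apply: (maxcl_lcn_exponent p_pr maxG i_gt1) Ly.
    apply: abL Ln1 _; exact: leq_trans (ltnW lt_ni) le_ii.
  exact: leq_trans lt_ni (ltnW lt_iip).
pose N := 'L_i.+2(G)%G; have nGN : G \subset 'N(N) := lcn_norm _ G.
have maxQ : maximal_class p i.+2 (G / N).
  by apply: (maxcl_quotient p_pr maxG); rewrite le_in.
have nNy : y \in 'N(N) by rewrite (subsetP nGN) // (subsetP (lcn_sub i G)).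
apply: (@coset_idr _ N); rewrite ?groupX // morphX //.
apply: (maxcl_lcn_exponent p_pr maxQ i_gt1) => //; last first.
  by rewrite -quotient_lcn // mem_quotient.
by apply: abL le_ii; rewrite -quotient_lcn // trivg_quotient.
Qed.

(** The Frattini subgroup of [M] is normal in [G] and contains [b ^+ p], which is outside
    ['L_p.+1(G)]; by the chain of normal subgroups it contains ['L_p(G)]. *)
Lemma maxcl_Phi_P1 : p <= 3 -> p.+2 <= n -> 'L_p(G) \subset 'Phi(step_cent 2 G).
Proof.
move=> p_le3 le_pn; pose M := step_cent_group 2 G; have p_gt1 := prime_gt1 p_pr.
have n_gt3 : 3 < n by apply: leq_trans le_pn; rewrite !ltnS.
have nsMG : M <| G := step_cent_normal 2 G.
have iMG : #|G : M| = p := maxcl_index_step_cent2 p_pr maxG n_gt3.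
have pM : p.-group M := pgroupS (normal_sub nsMG) pG.
have [b Mb nLb] : exists2 b, b \in M & b \notin 'L_2(G).
  apply/subsetPn; apply: contraTN (leqnn n) => sML; rewrite -ltnNge.
  have := dvdn_leq (indexg_gt0 _ _) (indexgS G sML).
  rewrite iMG -divgS ?lcn_sub // (maxcl_card maxG) (maxcl_card_lcn p_pr maxG) //.
  rewrite -expnB ?leq_subr ?prime_gt0 // subKn ?(ltnW (ltnW n_gt3)) //.
  by rewrite leqNgt -{1}(expn1 p) ltn_exp2l.
have Phib : b ^+ p \in 'Phi(M).
  rewrite (Phi_joing pM) mem_gen // inE; apply/orP; right.
  by rewrite (Mho_p_elt 1 Mb) // (mem_p_elt pM).
have nsPG : 'Phi(M) <| G by apply: gFnormal_trans.
have /orP[/subsetP/(_ _ Phib) Lbp|//] := maxcl_normal_dich p_pr maxG p_gt1 nsPG.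
by case/negP: (maxcl_expg_P1 p_le3 le_pn Mb nLb).
Qed.
End MaximalClass.

(** [P1 G] is cyclic: its Frattini subgroup contains ['L_2(G)], which has index 2 in it. *)
Lemma maxcl2_P1_abelian (gT : finGroupType) (n : nat) (G : {group gT}) :
  maximal_class 2 n G -> 3 < n -> abelian (P1 G).
Proof.
move=> maxG n_gt3; have p_pr : prime 2 by [].
have pG := maxcl_pgroup p_pr maxG; pose M := step_cent_group 2 G.
have nsMG : M <| G := step_cent_normal 2 G; have sMG := normal_sub nsMG.
have iMG : #|G : M| = 2 := maxcl_index_step_cent2 p_pr maxG n_gt3.
have sLP : 'L_2(G) \subset 'Phi(M) := maxcl_Phi_P1 p_pr maxG isT n_gt3.
apply/cyclic_abelian/(@Phi_quotient_cyclic _ M)/(dvdn_prime_cyclic p_pr).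
rewrite card_quotient ?gFnorm //.
have sLM : 'L_2(G) \subset M by exact: lcn2_step_cent.
apply: dvdn_trans (indexgS M sLP) _.
rewrite -(dvdn_pmul2l (indexg_gt0 G M)) Lagrange_index // iMG.
rewrite -divgS ?lcn_sub // (maxcl_card maxG) (maxcl_card_lcn p_pr maxG) //.
by rewrite -expnB ?leq_subr // subKn ?(ltnW (ltnW n_gt3)).
Qed.

Lemma maxcl_index_lcn2_step_cent2 (gT : finGroupType) (p n : nat) (G : {group gT}) :
  prime p -> maximal_class p n G -> 3 < n -> #|step_cent 2 G : 'L_2(G)| = p.
Proof.
move=> p_pr maxG n_gt3; have sLM := lcn2_step_cent G (isT : 0 < 2).
pose M := step_cent_group 2 G; rewrite -[step_cent 2 G]/(gval M) in sLM *.
have iMG : #|G : M| = p := maxcl_index_step_cent2 p_pr maxG n_gt3.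
apply/eqP; rewrite -(eqn_pmul2l (indexg_gt0 G M)).
rewrite (Lagrange_index (normal_sub (step_cent_normal 2 G)) sLM) iMG.
rewrite -divgS ?lcn_sub // (maxcl_card maxG) (maxcl_card_lcn p_pr maxG) //.
by rewrite -expnB ?leq_subr ?prime_gt0 // subKn ?(ltnW (ltnW n_gt3)).
Qed.

(** [M / 'L_4(G)] is abelian, being cyclic modulo its central subgroup ['L_2(G) / 'L_4(G)]. *)
Lemma maxcl_der1_P1 (gT : finGroupType) (p n : nat) (G : {group gT}) :
  prime p -> maximal_class p n G -> 3 < n -> (step_cent 2 G)^`(1) \subset 'L_4(G).
Proof.
move=> p_pr maxG n_gt3; pose M := step_cent_group 2 G; rewrite -[step_cent 2 G]/(gval M).
have nsMG : M <| G := step_cent_normal 2 G; have sMG := normal_sub nsMG.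
have sLM : 'L_2(G) \subset M by exact: lcn2_step_cent.
have nM4 : M \subset 'N('L_4(G)) := subset_trans sMG (lcn_norm 4 G).
apply: der1_min => //.
have sLZ : 'L_2(G) / 'L_4(G) \subset 'Z(M / 'L_4(G)).
  rewrite subsetI quotientS //= quotient_cents2 ?(subset_trans sLM) //.
  rewrite gen_subG; apply/subsetP=> _ /imset2P[y x Ly /step_centP[_ cx] ->].
  exact: cx.
apply: cyclic_factor_abelian sLZ _; apply: (dvdn_prime_cyclic p_pr).
have nM2 : M \subset 'N('L_2(G)) := subset_trans sMG (lcn_norm 2 G).
rewrite card_quotient ?quotient_norms // (index_quotient_eq _ sLM nM4).
  by rewrite (maxcl_index_lcn2_step_cent2 p_pr maxG).
by rewrite (subset_trans (subsetIr _ _)) // lcn_sub_leq.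
Qed.

(** Let [M^](1) = 'L_l(G)[. Modulo]N =
    'L_l.+2(G)[, the cube of a generator]b[of]M[is central in]M[, which forces]'L_3(G)[to be central in]M[modulo]N[. Then]M^[(1) / N]
    has order at most 3, which is possible only if [N] is trivial. *)
Lemma maxcl3_P1_central (gT : finGroupType) (n : nat) (G : {group gT}) :
  maximal_class 3 n G -> 4 < n -> 'L_3(G) \subset 'Z(step_cent 2 G).
Proof.
have arith a b : b.+2 <= a -> a - b - (a - b.+2) = 2 by lia.
move=> maxG n_gt4; have p_pr : prime 3 by []. have n_gt3 := ltnW n_gt4.
have pG := maxcl_pgroup p_pr maxG; pose M := step_cent_group 2 G.
rewrite -[step_cent 2 G]/(gval M).
have L1 k : (n <= k) = ('L_k(G) == 1) := maxcl_lcn1 p_pr maxG k.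
have nsMG : M <| G := step_cent_normal 2 G; have sMG := normal_sub nsMG.
have sLM : 'L_2(G) \subset M by exact: lcn2_step_cent.
have pM : 3.-group M := pgroupS sMG pG.
have sLP : 'L_3(G) \subset 'Phi(M) := maxcl_Phi_P1 p_pr maxG isT n_gt4.
have iML : #|M : 'L_2(G)| = 3 := maxcl_index_lcn2_step_cent2 p_pr maxG n_gt3.
have sM4 : M^`(1) \subset 'L_4(G) := maxcl_der1_P1 p_pr maxG n_gt3.
have nsM'G : M^`(1) <| G by apply: gFnormal_trans.
have [l l_gt1 defM'] : exists2 l, 1 < l & M^`(1) = 'L_l(G).
  have [sL2M'|[l /andP[l1 _] ->]] := maxcl_normal p_pr maxG nsM'G; last by exists l.
  have := subset_trans sL2M' sM4; have := maxcl_lcn_proper p_pr maxG (isT : 0 < 2) (ltnW n_gt3).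
  rewrite properE => /andP[_ /negP[]]; apply: subset_trans (lcn_subS 3 G).
  exact: subset_trans sL2M' sM4.
have [b Mb nLb] : exists2 b, b \in M & b \notin 'L_2(G).
  by apply/subsetPn; rewrite -indexg_eq1 iML.
have /properP[_ [c Lc nLc]] := maxcl_lcn_proper p_pr maxG (isT : 0 < 2) (ltnW n_gt3).
have Mc : c \in M := subsetP sLM c Lc.
(* [b] and [c] generate [M] modulo ['L_3(G)], which lies in the Frattini subgroup. *)
have genM : <<[set b; c]>> = M.
  apply: Phi_nongen; apply/eqP; rewrite eqEsubset join_subG Phi_sub.
  rewrite subUset !sub1set Mb Mc /=.
  have sP : 'L_3(G) \subset 'Phi(M) <*> [set b; c] by rewrite (subset_trans sLP) ?joing_subl.
  have Pb : b \in 'Phi(M) <*> [set b; c] by rewrite mem_gen // !inE eqxx !orbT.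
  have Pc : c \in 'Phi(M) <*> [set b; c] by rewrite mem_gen // !inE eqxx !orbT.
  have sP2 : 'L_2(G) \subset 'Phi(M) <*> [set b; c].
    by rewrite -(maxcl_lcn_gen p_pr maxG (isT : 1 < 2) Lc nLc) mul_subG ?cycle_subG.
  have : 'L_2(G) * <[b]> \subset 'Phi(M) <*> [set b; c] by rewrite mul_subG ?cycle_subG.
  by rewrite (mulg_index_prime pM p_pr sLM iML Mb nLb).
pose N := 'L_l.+2(G)%G; have nGN : G \subset 'N(N) := lcn_norm _ G.
have nMN := subset_trans sMG nGN.
have [Gb Gc] : b \in G /\ c \in G by rewrite !(subsetP sMG).
have [nNb nNc] : b \in 'N(N) /\ c \in 'N(N) by rewrite !(subsetP nGN).
set f := [~ b, c]; have Lf : f \in 'L_l(G) by rewrite -defM' mem_commg.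
have Gf : f \in G by rewrite groupR. have nNf : f \in 'N(N) by rewrite (subsetP nGN).
have Lfb : [~ f, b] \in 'L_l.+1(G).
  by case: (l) l_gt1 Lf => // k _ Lf; rewrite lcnSn mem_commg.
have cfb x : x \in G -> commute (coset N x) (coset N [~ f, b]).
  move=> Gx; apply/commute_sym/commgP; rewrite -morphR ?(subsetP nGN) ?groupR //.
  by apply/eqP/coset_id; rewrite /= lcnSn mem_commg.
have cosetR : coset N [~ f, b] = [~ coset N f, coset N b] by rewrite morphR.
(* Modulo [N], [(b * f) ^+ 3 = b ^+ 3], since the cubes of [f] and of [[~ f, b]] lie in [N]; and
   [b * f = b ^ c]. *)
have cbc : commute (coset N b ^+ 3) (coset N c).
  have := expMg_Rmul 3 (x := coset N f) (y := coset N b).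
  rewrite -cosetR => /(_ (cfb f Gf) (cfb b Gb)).
  rewrite -(morphX _ _ nNf) /= [coset N (f ^+ 3)]coset_id; last first.
    exact: (maxcl_lcn_expg p_pr maxG).
  rewrite -[coset N [~ f, b] ^+ _](morphX _ _ (subsetP nGN _ (groupR Gf Gb))) /=.
  rewrite [coset N ([~ f, b] ^+ _)]coset_id; last first.
    apply: subsetP (maxcl_lcn_expg p_pr maxG isT (leqW l_gt1) Lfb).
    exact: lcn_sub_leq.
  rewrite !mulg1 /f morphR // -conjg_mulR -conjXg => cb.
  by apply/commgP; rewrite commgEl cb mulVg.
have genMN : M / N = <<[set coset N b; coset N c]>>.
  rewrite -[in LHS]genM quotient_gen ?subUset ?sub1set ?nNb ?nNc //.
  by rewrite quotientU !quotient_set1.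
have Zb3 : coset N (b ^+ 3) \in 'Z(M / N).
  apply/setIP; split; first by rewrite mem_quotient // groupX.
  rewrite genMN cent_gen morphX //; apply/centP=> _ /set2P[] -> //.
  exact/commute_sym/commuteX.
pose K := (coset N @*^-1 'Z(M / N))%G.
have nsKG : K <| G.
  have : 'Z(M / N) <| G / N by apply: gFnormal_trans; apply: quotient_normal.
  by rewrite -(cosetpre_normal (H := N)) quotientGK // lcn_normal.
(* [K] is normal in [G] and contains [b ^+ 3], which is not in ['L_4(G)]. *)
have sL3K : 'L_3(G) \subset K.
  have /orP[sK4|//] := maxcl_normal_dich p_pr maxG (isT : 1 < 3) nsKG.
  case/negP: (maxcl_expg_P1 p_pr maxG isT n_gt4 Mb nLb); apply: (subsetP sK4).
  by rewrite mem_morphpre ?(groupX 3 nNb) //.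
have sL3Z : 'L_3(G) / N \subset 'Z(M / N).
  by have := quotientS N sL3K; rewrite cosetpreK.
have sM3 : M^`(1) \subset 'L_3(G) := subset_trans sM4 (lcn_subS 3 G).
have Zf : coset N f \in 'Z(M / N).
  by rewrite (subsetP sL3Z) // mem_quotient // (subsetP sM3) // mem_commg.
have f3 : coset N f ^+ 3 = 1.
  rewrite -morphX //; apply: coset_id; exact: (maxcl_lcn_expg p_pr maxG).
(* [f] is central in [M / N], so it alone generates the derived subgroup there, and its cube is
   trivial. *)
have oM' : #|M^`(1) / N| %| 3.
  have -> : M^`(1) / N = <[coset N f]>.
    have defMN : <[coset N b]> <*> <[coset N c]> = M / N.
      by rewrite joing_idl joing_idr genMN.
    have := @der1_joing_cycles _ (coset N b) (coset N c).
    rewrite /= defMN quotient_der // /f morphR //; apply.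
    by rewrite -morphR //; case/setIP: Zf.
  by rewrite -orderE order_dvdn f3.
(* If [l.+2 < n], the section ['L_l(G) / 'L_l.+2(G)] would have order 9. *)
have L_N : N :=: 1.
  apply/eqP; rewrite -L1 leqNgt; apply/negP => lt_l2n.
  move: oM'; rewrite defM' card_quotient; last first.
    exact: subset_trans (lcn_sub l G) nGN.
  have le_l2 : l <= l.+2 by rewrite -addn2 leq_addr.
  rewrite -divgS ?lcn_sub_leq // !(maxcl_card_lcn p_pr maxG) //.
  rewrite -expnB ?leq_sub2l //; suffices -> : n - l - (n - l.+2) = 2 by [].
  exact: arith (ltnW lt_l2n).
rewrite subsetI (subset_trans (lcn_subS 2 G)) //=; apply/commG1P/trivgP; rewrite -L_N.
rewrite -quotient_cents2 ?(subset_trans (lcn_sub 3 G)) //.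
by apply: subset_trans sL3Z _; apply: subsetIr.
Qed.

(** Outside [M], the centralizer of [s] meets [M] inside ['L_3(G)], hence in ['Z(G)]. Inside [M], a
    nonabelian [H] must be all of [M]: the product of [H] with the central ['L_3(G)] is [M], as
    otherwise it would be cyclic over ['L_3(G)], and ['L_3(G)] lies in the Frattini subgroup. *)
Lemma maxcl3_selfcentralizing (gT : finGroupType) (n : nat) (G : {group gT}) :
  maximal_class 3 n G -> 4 < n -> nonabelian_selfcentralizing G.
Proof.
move=> maxG n_gt4; have arith : n - 2 - (n - 3) = 1%N by lia.
move=> H sHG nabH; have p_pr : prime 3 by []. have n_gt3 := ltnW n_gt4.
have pG := maxcl_pgroup p_pr maxG; pose M := step_cent_group 2 G.
have nsMG : M <| G := step_cent_normal 2 G; have sMG := normal_sub nsMG.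
have sLM : 'L_2(G) \subset M by exact: lcn2_step_cent.
have sLZ : 'L_3(G) \subset 'Z(M) := maxcl3_P1_central maxG n_gt4.
have sLP : 'L_3(G) \subset 'Phi(M) := maxcl_Phi_P1 p_pr maxG isT n_gt4.
have ltMG : M \proper G by apply: (maxcl_step_cent_proper p_pr maxG).
have pM : 3.-group M := pgroupS sMG pG.
have sLM3 : 'L_3(G) \subset M by apply: subset_trans sLZ (subsetIl _ _).
have nM3 : M \subset 'N('L_3(G)) := subset_trans sMG (lcn_norm 3 G).
have iML : #|M : 'L_2(G)| = 3 := maxcl_index_lcn2_step_cent2 p_pr maxG n_gt3.
have [sHM|] := boolP (H \subset M); last first.
  have iMG : #|G : M| = 3 := maxcl_index_step_cent2 p_pr maxG n_gt3.
  apply: (cent_sub_not_sub_maximal pG _ sMG iMG) => // [|s Gs nMs].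
    exact: (maxcl_card_center p_pr maxG (ltnW n_gt3)).
  apply/subsetP=> y /subcent1P[My csy].
  have cys : [~ y, s] = 1 by apply/eqP/commgP; apply: commute_sym.
  have Ly2 : y \in 'L_2(G).
    apply: contraT => nLy.
    case/negP: (maxcl_commg_notin3 p_pr maxG (ltnW n_gt3) ltMG sLM My nLy Gs nMs).
    by rewrite cys group1.
  have Ly3 : y \in 'L_3(G).
    apply: contraT => nLy.
    case/negP: (maxcl_commg_notin p_pr maxG (isT : 1 < 2) Gs nMs Ly2 nLy).
    by rewrite cys group1.
  have /centerP[_ cMy] := subsetP sLZ y Ly3.
  rewrite inE (subsetP sMG) //= -sub_cent1.
  rewrite -(mulg_index_prime pG p_pr sMG iMG Gs nMs) mul_subG //.
    by apply/subsetP=> x Mx; apply/cent1P/commute_sym/cMy.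
  by rewrite cycle_subG cent1C; apply/cent1P.
have defH : H :=: M.
  have defHL : H <*> 'L_3(G) = M.
    pose K := (H <*> 'L_3(G))%G; have sKM : K \subset M by rewrite join_subG sHM.
    have nabK : ~~ abelian K.
      by apply: contra nabH; apply: abelianS; apply: joing_subl.
    have sLK : 'L_3(G) \subset K by apply: joing_subr.
    have sLZK : 'L_3(G) \subset 'Z(K).
      rewrite subsetI sLK (subset_trans _ (centS sKM)) //.
      exact: subset_trans sLZ (subsetIr _ _).
    apply/eqP; rewrite eqEcard sKM /= -(Lagrange sLK) -(Lagrange sLM3).
    rewrite leq_pmul2l ?cardG_gt0 // leqNgt; apply: contra nabK => lt_i.
    apply: cyclic_factor_abelian sLZK _; apply: (dvdn_prime_cyclic p_pr).
    rewrite card_quotient ?(subset_trans sKM) //.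
    have iM3 : #|M : 'L_3(G)| = (3 ^ 2)%N.
      rewrite -(Lagrange_index sLM (lcn_subS 2 G)) iML -divgS ?lcn_subS //.
      rewrite !(maxcl_card_lcn p_pr maxG) // -expnB ?leq_sub2l //.
      by rewrite arith.
    have /p_natP[k ik] : 3.-nat #|K : 'L_3(G)| := pnat_dvd (dvdn_indexg _ _) (pgroupS sKM pM).
    rewrite ik iM3 ltn_exp2l // in lt_i *.
    by apply: (@dvdn_exp2l 3 k 1).
  rewrite -[RHS](@Phi_nongen _ M H) ?genGid //.
  apply/eqP; rewrite eqEsubset join_subG Phi_sub sHM /= -{1}defHL joingC.
  exact: genS (setSU _ sLP).
(* An element centralizing [M] centralizes ['L_2(G)], and so belongs to [M]. *)
rewrite defH; apply/subsetP=> x /setIP[Gx /centP cMx].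
apply/step_centP; split=> // y Ly; rewrite (_ : [~ y, x] = 1) ?group1 //.
by apply/eqP/commgP/commute_sym/cMx/(subsetP sLM).
Qed.

Lemma maxcl_n4_P1_abelian (gT : finGroupType) (p : nat) (G : {group gT}) :
  prime p -> maximal_class p 4 G -> abelian (P1 G).
Proof.
move=> p_pr maxG; apply/(derG1P (G := step_cent_group 2 G))/trivgP.
have /eqP <- : 'L_4(G) == 1 by rewrite -(maxcl_lcn1 p_pr maxG).
exact: (maxcl_der1_P1 p_pr maxG).
Qed.

(** * Primes at least 5 *)

(* The subgroup generated by a and b has order at most p^2 modulo L, while the
   centre of a nonabelian p-group has index at least p^2. *)
Lemma selfcentralizing_cent_sub (gT : finGroupType) (p : nat) (G L : {group gT}) a b :
    prime p -> p.-group G -> nonabelian_selfcentralizing G ->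
    a \in G -> b \in G -> L \subset 'C_G([set a; b]) ->
    a ^+ p \in L -> b ^+ p \in L -> [~ a, b] \in L -> [~ a, b] != 1 ->
  'C_G([set a; b]) \subset L.
Proof.
move=> p_pr pG scG Ga Gb sLC La Lb Lab ntab.
pose H := <<[set a; b]>>%G; have sHG : H \subset G by rewrite gen_subG subUset !sub1set Ga.
have [Ha Hb] : a \in H /\ b \in H by rewrite !mem_gen // !inE eqxx ?orbT.
have nabH : ~~ abelian H.
  apply: contra ntab => /centsP cHH; apply/commgP; exact: cHH.
rewrite -cent_gen -[<<_>>]/(gval H) in sLC *.
have sCH := scG H sHG nabH.
have sLZ : L \subset 'Z(H).
  by rewrite subsetI (subset_trans sLC sCH) (subset_trans sLC) ?subsetIr.
have sCZ : 'C_G(H) \subset 'Z(H) by rewrite subsetI sCH subsetIr.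
have sLH : L \subset H := subset_trans sLZ (center_sub H).
have nLH : H \subset 'N(L) by exact: (normal_norm (sub_center_normal sLZ)).
have [nLa nLb] : a \in 'N(L) /\ b \in 'N(L) by rewrite !(subsetP nLH).
have ocoset x : x \in H -> x ^+ p \in L -> #[coset L x] <= p.
  move=> Hx Lx; rewrite dvdn_leq ?prime_gt0 // order_dvdn.
  have nLx := subsetP nLH x Hx.
  by rewrite -morphX //=; apply/eqP/coset_id.
have iHL : #|H : L| <= p ^ 2.
  have cab : <[coset L b]> \subset 'C(<[coset L a]>).
    rewrite cent_cycle cycle_subG; apply/cent1P/commute_sym/commgP.
    by rewrite -morphR //=; apply/eqP/coset_id.
  rewrite -card_quotient //.
  have -> : H / L = <[coset L a]> * <[coset L b]>.
    rewrite -cent_joinEr // joing_idl joing_idr.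
    rewrite quotient_gen ?subUset ?sub1set ?nLa ?nLb //.
    by rewrite quotientU !quotient_set1.
  apply: leq_trans (_ : #|<[coset L a]>| * #|<[coset L b]>| <= _)%N.
    by rewrite mul_cardG leq_pmulr ?cardG_gt0.
  by rewrite -mulnn leq_mul // ocoset.
(* If [L] were properly contained in ['Z(H)], the index of ['Z(H)] would be less than [p ^ 2] and
   [H] would be abelian. *)
apply: subset_trans sCZ _; apply: contraR nabH => nsZL.
apply: cyclic_center_factor_abelian; apply: (dvdn_prime_cyclic p_pr).
rewrite card_quotient ?gFnorm //.
have /p_natP[j ij] : p.-nat #|H : 'Z(H)|.
  exact: pnat_dvd (dvdn_indexg _ _) (pgroupS sHG pG).
have lt_ip : #|H : 'Z(H)| < p ^ 2.
  apply: leq_trans iHL; rewrite -(Lagrange_index (center_sub H) sLZ).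
  rewrite ltn_Pmulr // ltn_neqAle indexg_gt0 andbT eq_sym.
  by rewrite indexg_eq1.
rewrite ij ltn_exp2l ?prime_gt1 // in lt_ip *.
by apply: (@dvdn_exp2l p j 1).
Qed.

(** * Commutators of b with an abelian term of index p in B *)

Section NormalPair.
Variables (gT : finGroupType) (p n m k : nat) (G B : {group gT}) (b : gT).
Hypotheses (p_pr : prime p) (maxG : maximal_class p n G) (m_gt1 : 1 < m).
Hypotheses (lt_mk : m < k) (lt_kn : k < n) (nsBG : B <| G).
Hypotheses (sAB : 'L_m(G) \subset B) (iBA : #|B : 'L_m(G)| = p).
Hypotheses (cAA : abelian 'L_m(G)) (defZ : 'Z(B) = 'L_k(G)).
Hypotheses (Bb : b \in B) (nAb : b \notin 'L_m(G)).
Let pG := maxcl_pgroup p_pr maxG.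

Let defB : 'L_m(G) * <[b]> = B.
Proof. exact: mulg_index_prime (pgroupS (normal_sub nsBG) pG) p_pr sAB iBA Bb nAb. Qed.

Let Gb : b \in G. Proof. exact: subsetP (normal_sub nsBG) b Bb. Qed.

(** On the abelian normal subgroup ['L_m(G)], the map [a] to [[~ b, a]] is a homomorphism. *)
Lemma lcn_commg_group_set i : m <= i -> group_set [set [~ b, a] | a in 'L_i(G)].
Proof.
move=> le_mi; have sLA : 'L_i(G) \subset 'L_m(G) := lcn_sub_leq G le_mi.
apply/group_setP; split; first by apply/imsetP; exists 1; rewrite ?commg1.
move=> _ _ /imsetP[x Lx ->] /imsetP[y Ly ->].
apply/imsetP; exists (y * x); first exact: groupM.
have Abx : [~ b, y] \in 'L_m(G).
  have Ay := subsetP sLA y Ly.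
  rewrite -groupV invg_comm commgEl groupM ?groupV //.
  by rewrite memJ_norm ?(subsetP (lcn_norm m G)).
rewrite commgMJ; congr (_ * _); rewrite /conjg.
by rewrite ((centsP cAA) _ Abx x (subsetP sLA x Lx)) mulKg.
Qed.

(** The set is a translate of the orbit of [b] under ['L_i(G)], where the stabilizer is
    ['Z(B) = 'L_k(G)]. *)
Lemma lcn_commg_card i : m <= i <= k ->
  #|[set [~ b, a] | a in 'L_i(G)]| = (p ^ (k - i))%N.
Proof.
case/andP=> le_mi le_ik; have sLA : 'L_i(G) \subset 'L_m(G) := lcn_sub_leq G le_mi.
have -> : [set [~ b, a] | a in 'L_i(G)] = b^-1 *: (b ^: 'L_i(G)).
  apply/setP=> x; rewrite mem_lcoset invgK; apply/imsetP/imsetP=> -[a La def_x].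
    by exists a; rewrite // def_x commgEl mulKVg.
  by exists a; rewrite // commgEl -def_x mulKg.
rewrite card_lcoset -index_cent1.
have -> : 'C_('L_i(G))[b] = 'L_k(G).
  apply/eqP; rewrite eqEsubset subsetI (lcn_sub_leq G le_ik) /=; apply/andP; split.
    apply/subsetP=> x /subcent1P[Lx cbx]; rewrite -defZ inE.
    rewrite (subsetP sAB) ?(subsetP sLA) //= -sub_cent1 -defB mul_subG //.
      by rewrite sub_cent1 (subsetP cAA) ?(subsetP sLA).
    by rewrite cycle_subG cent1C; apply/cent1P.
  by rewrite -defZ subIset // -cent_set1 centS ?orbT ?sub1set.
rewrite -divgS ?lcn_sub_leq // !(maxcl_card_lcn p_pr maxG); last 2 first.
- exact: ltn_trans m_gt1 lt_mk.
- exact: leq_trans m_gt1 le_mi.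
rewrite -expnB ?prime_gt0 ?leq_sub2l //; congr (_ ^ _)%N.
by move: (ltnW lt_kn) le_ik; lia.
Qed.

(** The set is a normal subgroup of [G], since a conjugate of [b] is [x * b ^+ j] with [x] in the
    abelian ['L_m(G)]; its order [p ^ (k - i)] then determines which term it is. *)
Lemma lcn_commgE i : m <= i <= k ->
  [set [~ b, a] | a in 'L_i(G)] = 'L_(n - (k - i))(G).
Proof.
move=> i_in; have /andP[le_mi le_ik] := i_in.
have idx1 : 1 < n - (k - i) <= n by move: m_gt1 le_mi (ltnW lt_kn) le_ik; clear; lia.
have idx2 : n - (n - (k - i)) = k - i by move: (ltnW lt_kn); clear; lia.
have sLA : 'L_i(G) \subset 'L_m(G) := lcn_sub_leq G le_mi.
have nLi g : g \in G -> g \in 'N('L_i(G)) by apply/subsetP/lcn_norm.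
pose D := Group (lcn_commg_group_set le_mi); rewrite -[LHS]/(gval D).
have nbD : b \in 'N(D).
  rewrite inE; apply/subsetP=> _ /imsetP[_ /imsetP[a La ->] ->].
  rewrite conjRg [b ^ b]conjgE mulKg; apply/imsetP; exists (a ^ b) => //.
  by rewrite memJ_norm ?nLi.
have Dbj j a : a \in 'L_i(G) -> [~ b ^+ j, a] \in D.
  move=> La; elim: j => [|j IHj]; first by rewrite comm1g group1.
  rewrite expgS commMgJ groupM // memJ_norm ?groupX //.
  by apply/imsetP; exists a.
have nsDG : D <| G.
  apply/andP; split.
    apply/subsetP=> _ /imsetP[a La ->]; rewrite groupR //.
    exact: subsetP (lcn_sub i G) a La.
  apply/subsetP=> g Gg; rewrite inE; apply/subsetP=> _ /imsetP[_ /imsetP[a La ->] ->].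
  rewrite conjRg; have Lag : a ^ g \in 'L_i(G) by rewrite memJ_norm ?nLi.
  have : b ^ g \in B by rewrite memJ_norm // (subsetP (normal_norm nsBG)).
  rewrite -defB => /mulsgP[x _ Ax /cycleP[j ->] ->].
  rewrite commMgJ (_ : [~ x, _] = 1) ?conj1g ?mul1g ?Dbj //.
  by apply/eqP/commgP/(centsP cAA) => //; apply: subsetP Lag.
by apply: (maxcl_normal_card p_pr maxG idx1 nsDG); rewrite idx2 lcn_commg_card.
Qed.
End NormalPair.

Lemma expg_index_mem (gT : finGroupType) (G N : {group gT}) x :
  N <| G -> x \in G -> x ^+ #|G : N| \in N.
Proof.
case/andP=> sNG nNG Gx; have nNx := subsetP nNG x Gx.
rewrite -card_quotient //; apply: coset_idr; first exact: groupX.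
by rewrite morphX //= expg_cardG ?mem_quotient.
Qed.

(** For a minimal nonabelian normal [B], any [G]-normal subgroup of index [p] in [B] is abelian. *)
Lemma exists_min_nonabelian_normal (gT : finGroupType) (p : nat) (G M : {group gT}) :
    prime p -> p.-group G -> M <| G -> ~~ abelian M ->
  exists A B : {group gT}, [/\ A <| G, B <| G, A \subset B, B \subset M
    & [/\ #|B : A| = p, abelian A & ~~ abelian B]].
Proof.
move=> p_pr pG nsMG nabM; pose P (H : {group gT}) := (H <| G) && ~~ abelian H.
have [B /mingroupP[/andP[nsBG nabB] minB] sBM] : {B | [min B | P B] & B \subset M}.
  by apply: mingroup_exists; rewrite /P nsMG.
have pB : p.-group B := pgroupS (normal_sub nsBG) pG.
have ntB : B :!=: 1 by apply: contraNneq nabB => ->; apply: abelian1.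
have [_ _ [r oB]] := pgroup_pdiv pB ntB.
have [A [sAB nsAG oA]] := normal_pgroup pG nsBG (leq_pred (logn p #|B|)).
rewrite oB pfactorK //= in oA.
exists A, B; split=> //; split=> //.
  by rewrite -divgS // oB oA expnS mulnK // expn_gt0 prime_gt0.
apply: contraT => nabA; have defA := minB A; rewrite /P nsAG nabA in defA.
have /eqP := oA; rewrite (defA isT sAB) oB eqn_exp2l ?prime_gt1 //.
by rewrite eqn_leq ltnn.
Qed.

Lemma maxcl_selfcentralizing_P1_abelian (gT : finGroupType) (p n : nat) (G : {group gT}) :
    prime p -> maximal_class p n G -> 5 <= p -> 4 <= n ->
  nonabelian_selfcentralizing G -> abelian (P1 G).
Proof.
move=> p_pr maxG p_ge5 n_ge4 scG; apply: contraT => nabM.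
have p_gt1 := prime_gt1 p_pr; have p_gt0 := prime_gt0 p_pr.
have pG := maxcl_pgroup p_pr maxG; pose M := step_cent_group 2 G.
have nsMG : M <| G := step_cent_normal 2 G.
have L1 k : n <= k -> 'L_k(G) = 1 by rewrite (maxcl_lcn1 p_pr maxG) => /eqP.
have oL i : 1 < i -> #|'L_i(G)| = (p ^ (n - i))%N by exact: maxcl_card_lcn.
have ltL i j : 0 < i -> i < j -> i < n -> ~~ ('L_i(G) \subset 'L_j(G)).
  move=> i_gt0 lt_ij lt_in; have := maxcl_lcn_proper p_pr maxG i_gt0 lt_in.
  rewrite properE => /andP[_]; apply: contra => /subset_trans; apply.
  exact: lcn_sub_leq.
have [A [B [nsAG nsBG sAB sBM [iBA cAA nabB]]]] :=
  exists_min_nonabelian_normal p_pr pG nsMG nabM.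
have [sAG sBG] := (normal_sub nsAG, normal_sub nsBG).
have pB : p.-group B := pgroupS sBG pG.
have iGM : #|G : M| = p := maxcl_index_step_cent2 p_pr maxG n_ge4.
have le_iA : p ^ 2 <= #|G : A|.
  rewrite -(Lagrange_index sBG sAB) iBA -mulnn leq_mul2r; apply/orP; right.
  by rewrite -iGM dvdn_leq ?indexgS.
(* As [A] has index at least [p ^ 2], containing ['L_2(G)] means being equal to it. *)
have [m [m_gt1 le_mn defA]] : exists m, [/\ 1 < m, m <= n & A :=: 'L_m(G)].
  have [sLA|[m /andP[m1 mn] ->]] := maxcl_normal p_pr maxG nsAG; last by exists m.
  exists 2; split=> //; first exact: ltnW (ltnW n_ge4).
  apply/esym/eqP; rewrite eqEcard sLA /= -(leq_pmul2r (indexg_gt0 G A)) Lagrange //.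
  apply: leq_trans (leq_mul (leqnn _) le_iA).
  by rewrite oL // -expnD subnK ?(maxcl_card maxG) // (ltnW (ltnW n_ge4)).
have {}cAA : abelian 'L_m(G) by rewrite -defA.
rewrite defA in nsAG sAG sAB iBA le_iA.
have [b Bb nAb] : exists2 b, b \in B & b \notin 'L_m(G).
  by apply/subsetPn; rewrite -indexg_eq1 iBA neq_ltn p_gt1 orbT.
have Gb := subsetP sBG b Bb.
have defB : 'L_m(G) * <[b]> = B := mulg_index_prime pB p_pr sAB iBA Bb nAb.
have nsZG : 'Z(B) <| G by apply: gFnormal_trans.
have nsAZ : ~~ ('L_m(G) \subset 'Z(B)).
  apply: contra nabB => sAZ.
  apply: cyclic_center_factor_abelian; apply: (dvdn_prime_cyclic p_pr).
  by rewrite card_quotient ?gFnorm // -iBA indexgS.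
have [k [lt_mk lt_kn defZ]] : exists k, [/\ m < k, k < n & 'Z(B) = 'L_k(G)].
  have [sLZ|[k /andP[k_gt1 le_kn] defZ]] := maxcl_normal p_pr maxG nsZG.
    by case/negP: nsAZ; apply: subset_trans sLZ; apply: lcn_sub_leq.
  exists k; split=> //.
    by rewrite ltnNge; apply: contra nsAZ => le_km; rewrite defZ lcn_sub_leq.
  rewrite ltnNge; apply: contra nabB => /L1 Lk1.
  by have /eqP := defZ; rewrite Lk1 (center_nil_eq1 (pgroup_nil pB)) => /eqP->; apply: abelian1.
have k_gt1 := ltn_trans m_gt1 lt_mk.
have commE := lcn_commgE p_pr maxG m_gt1 lt_mk lt_kn nsBG sAB iBA cAA defZ Bb nAb.
have sLA i : m <= i -> 'L_i(G) \subset 'L_m(G) by apply: lcn_sub_leq.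
have m1E : m.-1.+1 = m by rewrite prednK // ltnW.
have sBL : B \subset 'L_m.-1(G).
  case: (leqP m.-1 1) => [|m1_gt1]; first by case: (m.-1) => [|[]].
  suffices -> : B :=: 'L_m.-1(G) by [].
  have le_m1n : m.-1 <= n := leq_trans (leq_pred m) le_mn.
  apply: (maxcl_normal_card p_pr maxG _ nsBG); first by rewrite m1_gt1.
  rewrite -(Lagrange sAB) iBA oL // -expnSr -{1}m1E subnSK // m1E.
  exact: le_mn.
have defBc x : x \in 'L_m(G) -> commute x b -> x \in 'L_k(G).
  move=> Ax cxb; rewrite -defZ inE (subsetP sAB) //= -sub_cent1 -defB mul_subG //.
    by rewrite sub_cent1 (subsetP cAA).
  by rewrite cycle_subG cent1C; apply/cent1P.
have Lk_cent x y : x \in 'L_k(G) -> y \in B -> commute x y.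
  by rewrite -defZ => /centerP[_ cBx] /cBx.
(* [[~ b, A]] is ['L_(n - (k - m))(G)] and lies in ['L_m.+2(G)]: for [m = 2] because [b] is in
   [P1 G], for [m > 2] because [B] lies in ['L_m.-1(G)]. Comparing indices gives the bound. *)
have le_k2n : k.+2 <= n.
  have sDL : 'L_(n - (k - m))(G) \subset 'L_m.+2(G).
    rewrite -commE ?leqnn ?(ltnW lt_mk) //.
    apply/subsetP=> _ /imsetP[x Lx ->]; rewrite -groupV invg_comm.
    have [m2|m_gt2] := leqP m 2.
      have {m2} m2 : m = 2 by apply/eqP; rewrite eqn_leq m2.
      rewrite m2 in Lx *.
      by have /step_centP[_] := subsetP sBM b Bb; apply.
    have m1_gt0 : 0 < m.-1 by rewrite -ltnS m1E ltnW.
    have := subsetP (lcn_comm G (ltnW m_gt1) m1_gt0) [~ x, b].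
    rewrite mem_commg ?(subsetP sBL) // => /(_ isT); apply: subsetP.
    apply: lcn_sub_leq; rewrite -addn2 leq_add2l -ltnS m1E //.
  rewrite ltnNge; apply/negP=> le_nk1.
  have i1 : 0 < n - (k - m) by move: m_gt1 lt_mk lt_kn; clear; lia.
  have i2 : n - (k - m) < m.+2 by move: le_nk1 lt_mk; clear; lia.
  have i3 : n - (k - m) < n by move: lt_kn lt_mk; clear; lia.
  by case/negP: (ltL _ _ i1 i2 i3).
have bp : b ^+ p \in 'L_k(G).
  have nsAB : 'L_m(G) <| B by rewrite (normalS sAB sBG).
  apply: defBc; last exact/commute_sym/commuteX.
  by rewrite -iBA; apply: expg_index_mem nsAB Bb.
have [k1 kE] : exists k1, k = k1.+1 by exists k.-1; rewrite prednK // ltnW.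
have le_mk1 : m <= k1 by rewrite -ltnS -kE.
have k1_gt1 : 1 < k1 := leq_trans m_gt1 le_mk1.
(* [a] is taken from the last term not inside ['Z(B)], which makes [[~ b, a]] fall into
   ['L_n.-1(G)], of order [p]. *)
have [a La nLa] : exists2 a, a \in 'L_k1(G) & a \notin 'L_k(G).
  by rewrite kE; apply: (maxcl_lcn_notin p_pr maxG); rewrite -?kE ltnW // -kE ltnW.
have Lba : [~ b, a] \in 'L_n.-1(G).
  have /setP/(_ [~ b, a]) := commE k1 ltac:(by rewrite le_mk1 kE leqnSn).
  rewrite kE subSnn subn1 => <-; apply/imsetP; by exists a.
have iLk : #|'L_k1(G) : 'L_k(G)| = p.
  have le_k1k : k1 <= k by rewrite kE leqnSn.
  rewrite -divgS ?lcn_sub_leq // !oL // -expnB ?leq_sub2l // -[RHS](expn1 p).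
  congr (_ ^ _)%N; move: le_k2n; rewrite kE; clear; lia.
have LS (L : {group gT}) x : x \in 'L_m(G) -> x \notin 'L_k(G) -> L \subset 'L_k(G) ->
    x ^+ p \in L -> b ^+ p \in L -> [~ b, x] \in L -> 'L_k(G) \subset L.
  move=> Ax nLx sLL Lxp Lbp Lbx; have Bx := subsetP sAB x Ax.
  have sLC : 'L_k(G) \subset 'C_G([set x; b]).
    rewrite subsetI lcn_sub /=; apply/centsP=> y Ly z /set2P[]->; exact: Lk_cent.
  apply: (subset_trans sLC).
  apply: (selfcentralizing_cent_sub p_pr pG scG) => //.
  - exact: subsetP sBG x Bx.
  - exact: subset_trans sLL sLC.
  - by rewrite -groupV invg_comm.
  by apply: contra nLx => /commgP; apply: defBc.
have LE i y : m <= i -> n < i + p -> y \in 'L_i(G) -> y ^+ p = 1.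
  move=> le_mi lt_nip; apply: (maxcl_lcn_exponent p_pr maxG) lt_nip y.
    exact: leq_trans m_gt1 le_mi.
  exact: abelianS (sLA i le_mi) cAA.
have sLn1k : 'L_n.-1(G) \subset 'L_k(G).
  by apply: lcn_sub_leq; rewrite -ltnS prednK // (leq_ltn_trans _ lt_kn).
have n1_gt1 : 1 < n.-1 by apply: leq_trans k_gt1 _; rewrite -ltnS prednK // (leq_ltn_trans _ lt_kn).
have oLn1 : #|'L_n.-1(G)| = p.
  rewrite oL // -[RHS](expn1 p); congr (_ ^ _)%N; move: n_ge4; clear; lia.
(* Case [k <= n - 3]: [L] is generated by the [p]-th powers of ['L_k1(G)], by [b ^+ p] and by
   ['L_n.-1(G)], so its order is at most [#|T| * p ^ 2]. *)
have [le_k3n|lt_nk3] := leqP k.+3 n.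
  pose T := 'Mho^1('L_k1(G))%G.
  have cKK : abelian 'L_k1(G) := abelianS (sLA k1 le_mk1) cAA.
  have pK : p.-group 'L_k1(G) := pgroupS (lcn_sub k1 G) pG.
  have ET : T :=: [set x ^+ p | x in 'L_k1(G)] by rewrite /= (MhoEabelian 1 pK cKK) expn1.
  have sTL : T \subset 'L_k(G).
    rewrite ET; apply/subsetP=> _ /imsetP[x Lx ->]; rewrite -iLk expg_index_mem //.
    by rewrite kE lcn_normalS.
  pose X := (T <*> <[b ^+ p]>)%G; pose L := (X <*> 'L_n.-1(G))%G.
  have sXL : X \subset 'L_k(G) by rewrite join_subG sTL cycle_subG.
  have sLL : L \subset 'L_k(G) by rewrite join_subG sXL.
  have cLL : abelian 'L_k(G) := abelianS (sLA k (ltnW lt_mk)) cAA.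
  have sXL' : X \subset L := joing_subl _ _.
  have sLkL : 'L_k(G) \subset L.
    apply: (LS L a) => //; first exact: subsetP (sLA k1 le_mk1) a La.
    - apply: (subsetP sXL'); apply: (subsetP (joing_subl _ _)).
      by rewrite ET; apply: imset_f.
    - by apply: (subsetP sXL'); apply: (subsetP (joing_subr _ _)); apply: cycle_id.
    by apply: (subsetP (joing_subr _ _)).
  have leX : #|X| <= #|T| * p.
    have -> : #|X| = #|T * <[b ^+ p]>|.
      by rewrite /= cent_joinEr // (centSS _ sTL cLL) // cycle_subG.
    set c := b ^+ p; rewrite -(leq_pmul2r (cardG_gt0 (T :&: <[c]>))) -mul_cardG.
    rewrite -mulnA leq_mul2l; apply/orP; right.
    have sTc : <[c ^+ p]> \subset T :&: <[c]>.
      rewrite cycle_subG inE mem_cycle andbT ET; apply: imset_f.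
      by apply: subsetP bp; rewrite kE lcn_subS.
    apply: leq_trans (_ : p * #[c ^+ p] <= _)%N.
      apply: (@dvdn_leq #[c]); first by rewrite muln_gt0 p_gt0 order_gt0.
      by rewrite order_dvdn expgM expg_order.
    by rewrite leq_mul2l subset_leq_card ?orbT.
  have leL : #|L| <= #|T| * p * p.
    have -> : #|L| = #|X * 'L_n.-1(G)|.
      by rewrite /= cent_joinEr // (centSS sLn1k sXL cLL).
    rewrite -{2}oLn1; apply: leq_trans (_ : #|X| * #|'L_n.-1(G)| <= _)%N.
      by rewrite mul_cardG leq_pmulr ?cardG_gt0.
    by rewrite leq_mul2r leX orbT.
  have n4_gt1 : 1 < n - 4 by move: k1_gt1 le_k3n; rewrite kE; clear; lia.
  have le_k1n4 : k1 <= n - 4 by move: le_k3n; rewrite kE; clear; lia.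
  (* ['L_(n - 4)(G)] has order [p ^ 4] and exponent dividing [p], as [p > 4]. Hence
     [#|T| <= p ^ (n - k1 - 4)], and [L] is too small to contain ['L_k(G)]. *)
  have leO : p ^ 4 <= #|'Ohm_1('L_k1(G))|.
    have <- : #|'L_(n - 4)(G)| = (p ^ 4)%N by rewrite oL // subKn.
    apply: subset_leq_card; rewrite (OhmE 1 pK) expn1 sub_gen //.
    apply/subsetP=> y Ly; rewrite !inE (subsetP (lcn_sub_leq G le_k1n4)) //=.
    apply/eqP; apply: LE Ly; first exact: leq_trans le_mk1 le_k1n4.
    by rewrite -{1}(subnK n_ge4) ltn_add2l.
  have := mul_card_Ohm_Mho_abelian 1 cKK; rewrite (oL k1) // => oOT.
  have := leq_trans (subset_leq_card sLkL) leL; rewrite oL // => leZ.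
  have leT : (p ^ 4 * #|T| <= p ^ (n - k1))%N by rewrite -oOT leq_mul2r leO orbT.
  have : (p ^ 4 * p ^ (n - k) <= p ^ (n - k1) * p * p)%N.
    apply: leq_trans (leq_mul (leqnn _) leZ) _.
    by rewrite !mulnA leq_mul2r leq_mul2r leT !orbT.
  rewrite -expnD -!expnSr leq_exp2l //; move: le_k2n; rewrite kE; clear; lia.
have nE : n = k.+2 by apply/eqP; rewrite eqn_leq le_k2n andbT -ltnS.
have Lk1p y : y \in 'L_k1(G) -> y ^+ p = 1.
  by apply: LE => //; rewrite nE kE -addn3 ltn_add2l (leq_trans _ p_ge5).
have sLkk1 : 'L_k(G) \subset 'L_k1(G) by rewrite kE lcn_subS.
have n1E : n.-1 = k.+1 by rewrite nE.
(* Otherwise [L = 'L_n.-1(G)] would serve for [a], though it is smaller than ['L_k(G)]. *)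
have nLbp : b ^+ p \notin 'L_n.-1(G).
  apply/negP => Lbp; have /negP[] := ltL k n.-1 (ltnW k_gt1) ltac:(by rewrite n1E) lt_kn.
  apply: (LS 'L_n.-1(G)%G a) => //; first exact: subsetP (sLA k1 le_mk1) a La.
  by rewrite Lk1p ?group1.
(* Case [m <= n - 4]: [[~ b, 'L_(n - 4)(G)] = 'L_k(G)] contains [b ^+ p], so some [x] has [[~ b, x]
   = b ^+ p] and [x ^+ p = 1]; then [L = <[b ^+ p]>] has order at most [p], against
   [#|'L_k(G)| = p ^ 2]. *)
have [le_m4n|lt_nm4] := leqP (m + 4) n.
  have in4 : m <= n - 4 <= k by move: le_m4n; rewrite nE; clear; lia.
  have defLk : [set [~ b, x] | x in 'L_(n - 4)(G)] = 'L_k(G).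
    rewrite commE //; suffices -> : n - (k - (n - 4)) = k by [].
    by move: le_m4n m_gt1; rewrite nE; clear; lia.
  have : b ^+ p \in [set [~ b, x] | x in 'L_(n - 4)(G)] by rewrite defLk.
  case/imsetP=> x Lx bpE; have /andP[in4l _] := in4.
  have nLx : x \notin 'L_k(G).
    apply: contra nLbp => Lkx; rewrite bpE (_ : [~ b, x] = 1) ?group1 //.
    by apply/eqP/commgP/commute_sym/Lk_cent.
  have sLkb : 'L_k(G) \subset <[b ^+ p]>.
    apply: (LS <[b ^+ p]>%G x) => //; rewrite ?cycle_subG ?cycle_id //.
    - exact: subsetP (sLA _ in4l) x Lx.
    - rewrite (LE (n - 4)) ?group1 //.
      by rewrite -{1}(subnK n_ge4) ltn_add2l.
    by rewrite -bpE cycle_id.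
  have := subset_leq_card sLkb; rewrite oL // -orderE leqNgt => /negP[].
  apply: leq_ltn_trans (_ : p < _).
    by rewrite dvdn_leq // order_dvdn Lk1p // (subsetP sLkk1).
  by rewrite nE -addn2 addKn -{1}(expn1 p) ltn_exp2l.
have mk1 : m = k1.
  by apply/eqP; rewrite eqn_leq le_mk1 /=; move: lt_nm4; rewrite nE kE; clear; lia.
have cn1 x g : x \in 'L_n.-1(G) -> g \in G -> commute x g.
  move=> Lx Gg; apply/commgP; rewrite -in_set1 -[[set 1]](L1 n.-1.+1); last by rewrite n1E nE.
  by rewrite n1E in Lx *; rewrite lcnSn mem_commg.
(* [[~ b, g]] lies in ['L_m(G)], of exponent dividing [p], and its commutator with [b] is central of
   order dividing [p]. As [p] divides ['C(p, 2)], [(b ^ g) ^+ p = b ^+ p]. *)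
have Zbp : b ^+ p \in 'Z(G).
  apply/centerP; split=> [|g Gg]; first exact: groupX.
  have Lbg : [~ b, g] \in 'L_m(G).
    have := subsetP sBL b Bb; rewrite -{2}m1E; case: (m.-1) => [|j] Lb.
      by rewrite lcn1 groupR.
    by rewrite lcnSn mem_commg.
  have Lcb : [~ [~ b, g], b] \in 'L_n.-1(G).
    rewrite -groupV invg_comm.
    have /setP/(_ [~ b, [~ b, g]]) := commE k1 ltac:(by rewrite le_mk1 kE leqnSn).
    by rewrite kE subSnn subn1 => <-; apply/imsetP; exists [~ b, g]; rewrite // -mk1.
  have Gc : [~ b, g] \in G by rewrite groupR.
  have := expMg_Rmul p (commute_sym (cn1 _ _ Lcb Gc)) (commute_sym (cn1 _ _ Lcb Gb)).
  have /dvdnP[q ->] : p %| 'C(p, 2).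
    by rewrite prime_dvd_bin // (leq_trans _ p_ge5).
  have c1 : [~ [~ b, g], b] ^+ p = 1.
    by apply: Lk1p; apply: (subsetP sLkk1); apply: (subsetP sLn1k).
  have c2 : [~ b, g] ^+ p = 1 by apply: Lk1p; rewrite -mk1.
  rewrite mulnC expgM c1 c2 expg1n !mulg1.
  rewrite -conjg_mulR -conjXg => cbg.
  by apply/commgP; rewrite commgEl cbg mulVg.
have ZE : 'L_n.-1(G) = 'Z(G).
  apply/eqP; rewrite eqEcard oLn1 (maxcl_card_center p_pr maxG (ltnW n_ge4)) leqnn andbT.
  rewrite subsetI lcn_sub /=; apply/centsP=> x Lx g Gg; exact: cn1.
by rewrite ZE Zbp in nLbp.
Qed.

Theorem theorem6p13 (gT : finGroupType) (p n : nat) (G : {group gT}) :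
  prime p -> maximal_class p n G ->
  ((p == 2) || (p == 3) || (n <= 3) -> nonabelian_selfcentralizing G) /\
  (5 <= p -> 4 <= n -> (nonabelian_selfcentralizing G <-> abelian (P1 G))).
Proof.
move=> p_pr maxG; split=> [small_pn | p_ge5 n_ge4]; last first.
  split; first exact: maxcl_selfcentralizing_P1_abelian p_pr maxG p_ge5 n_ge4.
  exact: maxcl_P1_abelian_selfcentralizing p_pr maxG n_ge4.
have [|n_gt3] := leqP n 3; first exact: maxcl_le3_selfcentralizing p_pr maxG.
rewrite [n <= 3]leqNgt n_gt3 orbF in small_pn.
case/orP: small_pn => /eqP p_eq; rewrite p_eq in p_pr maxG.
  apply: (maxcl_P1_abelian_selfcentralizing p_pr maxG n_gt3).
  exact: maxcl2_P1_abelian maxG n_gt3.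
(* For [p = 3] and [n = 4] the derived subgroup of [P1 G] already lies in ['L_4(G) = 1]; the
   Frattini argument takes over from [n = 5]. *)
have [le_n4|] := leqP n 4; last exact: maxcl3_selfcentralizing.
have n4 : n = 4 by apply/eqP; rewrite eqn_leq le_n4.
apply: (maxcl_P1_abelian_selfcentralizing p_pr maxG n_gt3).
by rewrite n4 in maxG; apply: maxcl_n4_P1_abelian p_pr maxG.
Qed.
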